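(* Let $p=3$ and let $F=\langle x,y\mid x^3,y^3\rangle$ be the free product of two cyclic groups of order $3$. Then the following hold. (i) For an integer $n\geq 1$, the $p$-central quotient $F/\lambda_n(F)$ is a Beauville group if and only if $n\geq 4$. (ii) The series $\{\lambda_n(F)\}_{n\geq 4}$ can be refined to a normal series of $F$ (a descending series of normal subgroups of $F$ starting at $\lambda_4(F)$ and containing every $\lambda_n(F)$, $n\ge 4$, among its terms) such that any two consecutive terms of the series have index $p=3$ and for every term $N$ of the series $F/N$ is a Beauville group.
   Context: For a group $G$ and a prime $p$, the $p$-central series of $G$ is the series $G=\lambda_1(G)\geq \lambda_2(G)\geq\cdots$ defined by $\lambda_n(G)=[\lambda_{n-1}(G),G]\,\lambda_{n-1}(G)^p$ for $n>1$, where $H^p$ denotes the subgroup generated by all $p$-th powers of elements of $H$. The quotients $G/\lambda_n(G)$ are called the $p$-central quotients of $G$. Here $p=3$. For elements $x,y$ of a finite group $G$ put $$\Sigma(x,y)=\bigcup_{g\in G}\Big(\langle x\rangle^g\cup\langle y\rangle^g\cup\langle xy\rangle^g\Big),$$ where $H^g$ denotes the conjugate of $H$ by $g$. A finite group $G$ is a Beauville group if $G$ is a 2-generator group (i.e. its minimal number of generators is 2; in particular the trivial group is not a Beauville group) and there exist two generating sets $\{x_1,y_1\}$ and $\{x_2,y_2\}$ of $G$ such that $\Sigma(x_1,y_1)\cap\Sigma(x_2,y_2)=1$. *)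

(* Defs.v *)
From HB Require Import structures.
From mathcomp Require Import all_boot.
From mathcomp Require Import all_classical.

Set Implicit Arguments.
Unset Strict Implicit.
Unset Printing Implicit Defensive.

Local Open Scope classical_set_scope.
Local Open Scope quotient_scope.
Local Open Scope group_scope.

Section Subgroups.
Variable G : groupType.
Implicit Types (A B H K : set G) (x y g : G).

Definition is_subgroup H : Prop :=
  [/\ H 1, forall x y, H x -> H y -> H (x * y) & forall x, H x -> H x^-1].

Definition normal_subgroup H : Prop := is_subgroup H /\ forall x g, H x -> H (x ^ g).

Definition gen A : set G := smallest is_subgroup A.

Definition conj_set A g : set G := [set a ^ g | a in A].

Definition prod_set A B : set G := [set a * b | a in A & b in B].

Definition comm_subgroup A B : set G := gen [set [~ a, b] | a in A & b in B].

Definition power_subgroup (p : nat) A : set G := gen [set a ^+ p | a in A].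

Definition lcosets_of H K : set (set G) := [set [set h * k | k in K] | h in H].

Definition index_eq H K (m : nat) : Prop := (lcosets_of H K #= `I_m)%card.

Lemma subgroup_setT : is_subgroup setT.
Proof. by []. Qed.

Lemma normal_setT : normal_subgroup setT.
Proof. by []. Qed.

Lemma sub_gen A : A `<=` gen A.
Proof. exact: sub_gen_smallest. Qed.

Lemma subgroup_gen A : is_subgroup (gen A).
Proof.
split=> [B [[]] //|x y Ax Ay B BP|x Ax B BP].
- by have [[_ BM _] _] := BP; apply: BM; [exact: Ax | exact: Ay].
- by have [[_ _ BV] _] := BP; apply: BV; exact: Ax.
Qed.

Lemma normal_gen A : (forall x g, A x -> A (x ^ g)) -> normal_subgroup (gen A).
Proof.
move=> AJ; split; first exact: subgroup_gen.
move=> x g; rewrite /gen => Ax B [[B1 BM BV] AB].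
apply: (Ax [set y | B (y ^ g)]); split=> [|y /(AJ _ g)/AB//].
split=> [|y z By Bz|y By] /=.
- by rewrite conj1g.
- by rewrite conjMg; apply: BM.
- by rewrite conjVg; apply: BV.
Qed.

Lemma normal_comm_subgroup A B :
  normal_subgroup A -> normal_subgroup B -> normal_subgroup (comm_subgroup A B).
Proof.
move=> [_ AJ] [_ BJ]; apply: normal_gen => _ g [a Aa [b Bb <-]].
by exists (a ^ g); [exact: AJ | exists (b ^ g); [exact: BJ | rewrite conjRg]].
Qed.

Lemma normal_power_subgroup p A : normal_subgroup A -> normal_subgroup (power_subgroup p A).
Proof.
move=> [_ AJ]; apply: normal_gen => _ g [a Aa <-].
by exists (a ^ g); [exact: AJ | rewrite conjXg].
Qed.

Lemma normal_prod_set A B : normal_subgroup A -> normal_subgroup B -> normal_subgroup (prod_set A B).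
Proof.
move=> [[A1 AM AV] AJ] [[B1 BM BV] BJ]; split; first split.
- by exists 1 => //; exists 1 => //; rewrite mulg1.
- move=> _ _ [a Aa [b Bb <-]] [c Ac [d Bd <-]].
  exists (a * c); first exact: AM.
  exists (b ^ c * d); first by apply: BM => //; apply: BJ.
  by rewrite conjgE !mulgA mulgK.
- move=> _ [a Aa [b Bb <-]].
  exists a^-1; first exact: AV.
  exists (b^-1 ^ a^-1); first by apply: BJ; apply: BV.
  by rewrite conjgE invgK invgM !mulgA mulVg mul1g.
- move=> _ g [a Aa [b Bb <-]].
  exists (a ^ g); first exact: AJ.
  by exists (b ^ g); [exact: BJ | rewrite conjMg].
Qed.

Record nsubgroup := NSubgroup { nsubgroup_set :> set G; _ : normal_subgroup nsubgroup_set }.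

Lemma nsubgroupP (N : nsubgroup) : normal_subgroup N.
Proof. by case: N. Qed.

Section Quotient.
Variable N : nsubgroup.

Definition quotg_rel x y : bool := `[< (N : set G) (x^-1 * y) >].

Lemma quotg_rel_equiv : equiv_class_of quotg_rel.
Proof.
have [[N1 NM NV] _] := nsubgroupP N.
split=> [x|x y|y x z]; rewrite /quotg_rel.
- by apply/asboolP; rewrite mulVg.
- by apply/asbool_equiv_eq; split=> /NV; rewrite invgM invgK.
- move=> /asboolP Nxy /asboolP Nyz; apply/asboolP.
  by have := NM _ _ Nxy Nyz; rewrite mulgA mulgK.
Qed.

Canonical quotg_equiv := EquivRelPack quotg_rel_equiv.

Definition quotg : Type := {eq_quot quotg_equiv}.

HB.instance Definition _ := Choice.on quotg.
HB.instance Definition _ := EqQuotient.on quotg.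

Definition cosetg (x : G) : quotg := \pi_quotg x.
Definition quotg_one : quotg := cosetg 1.
Definition quotg_mul (a b : quotg) : quotg := cosetg (repr a * repr b).
Definition quotg_inv (a : quotg) : quotg := cosetg (repr a)^-1.

Lemma cosetgP x y : cosetg x = cosetg y <-> (N : set G) (x^-1 * y).
Proof.
split=> [/eqmodP/asboolP//|Nxy].
by apply/eqmodP/asboolP.
Qed.

Lemma cosetg_surj (a : quotg) : exists x, a = cosetg x.
Proof. by exists (repr a); rewrite /cosetg reprK. Qed.

Lemma cosetgM x y : quotg_mul (cosetg x) (cosetg y) = cosetg (x * y).
Proof.
have [[N1 NM NV] NJ] := nsubgroupP N.
apply/esym/cosetgP.
have /cosetgP Nx : cosetg x = cosetg (repr (cosetg x)) by rewrite /cosetg reprK.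
have /cosetgP Ny : cosetg y = cosetg (repr (cosetg y)) by rewrite /cosetg reprK.
have := NM _ _ (NJ _ y Nx) Ny.
by rewrite conjgE invgM !mulgA mulgK.
Qed.

Lemma cosetgV x : quotg_inv (cosetg x) = cosetg x^-1.
Proof.
have [[N1 NM NV] NJ] := nsubgroupP N.
apply/cosetgP.
have /cosetgP Nx : cosetg x = cosetg (repr (cosetg x)) by rewrite /cosetg reprK.
by have := NJ _ x^-1 Nx; rewrite conjgE !invgK !mulgA mulgV mul1g.
Qed.

Lemma quotg_mulA : associative quotg_mul.
Proof.
move=> a b c.
have [x ->] := cosetg_surj a; have [y ->] := cosetg_surj b.
have [z ->] := cosetg_surj c.
by rewrite !cosetgM mulgA.
Qed.

Lemma quotg_mul1 : left_id quotg_one quotg_mul.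
Proof. by move=> a; have [x ->] := cosetg_surj a; rewrite cosetgM mul1g. Qed.

Lemma quotg_mulr1 : right_id quotg_one quotg_mul.
Proof. by move=> a; have [x ->] := cosetg_surj a; rewrite cosetgM mulg1. Qed.

Lemma quotg_mulV : left_inverse quotg_one quotg_inv quotg_mul.
Proof.
by move=> a; have [x ->] := cosetg_surj a; rewrite cosetgV cosetgM mulVg.
Qed.

Lemma quotg_mulrV : right_inverse quotg_one quotg_inv quotg_mul.
Proof.
by move=> a; have [x ->] := cosetg_surj a; rewrite cosetgV cosetgM mulgV.
Qed.

HB.instance Definition _ := isGroup.Build quotg
  quotg_mulA quotg_mul1 quotg_mulr1 quotg_mulV quotg_mulrV.

End Quotient.

(** The index [n] starts at 1; [pcentral_set p 0] is a dummy value. *)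
Fixpoint pcentral_set (p n : nat) : set G :=
  match n with
  | 0 | 1 => setT
  | m.+1 => prod_set (comm_subgroup (pcentral_set p m) setT)
                     (power_subgroup p (pcentral_set p m))
  end.

Lemma normal_pcentral p n : normal_subgroup (pcentral_set p n).
Proof.
elim: n => [|[|n] IHn]; [exact: normal_setT | exact: normal_setT |].
apply: normal_prod_set; last exact: normal_power_subgroup.
exact: normal_comm_subgroup IHn normal_setT.
Qed.

Definition pcentral p n : nsubgroup := NSubgroup (normal_pcentral p n).

End Subgroups.

Definition min_generators (G : groupType) (d : nat) : Prop :=
  (exists2 s : seq G, size s = d & gen [set` s] = setT) /\
  (forall s : seq G, gen [set` s] = setT -> (d <= size s)%N).

Definition Sigma (G : groupType) (x y : G) : set G :=
  \bigcup_(g in [set: G])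
    (conj_set (gen [set x]) g `|` conj_set (gen [set y]) g
     `|` conj_set (gen [set x * y]) g).

Definition beauville (G : groupType) : Prop :=
  [/\ finite_set [set: G],
      min_generators G 2 &
      exists x1 y1 x2 y2 : G,
        [/\ gen [set x1; y1] = setT, gen [set x2; y2] = setT
          & Sigma x1 y1 `&` Sigma x2 y2 = [set 1]]].

Section Presentation.
Variable X : choiceType.

(** The letter [(a, false)] stands for [a] and [(a, true)] for [a^-1]. *)
Definition word : Type := seq (X * bool).

HB.instance Definition _ := Choice.on word.

Definition inv_letter (l : X * bool) : X * bool := (l.1, ~~ l.2).
Definition inv_word (u : word) : word := rev (map inv_letter u).

Variable R : set word.

Inductive pres_eq : word -> word -> Prop :=
| pres_refl u : pres_eq u u
| pres_sym u v : pres_eq u v -> pres_eq v u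
| pres_trans u v w : pres_eq u v -> pres_eq v w -> pres_eq u w
| pres_cat u u' v v' : pres_eq u u' -> pres_eq v v' -> pres_eq (u ++ v) (u' ++ v')
| pres_cancel l : pres_eq [:: l; inv_letter l] [::]
| pres_relator r : R r -> pres_eq r [::].

Definition pres_rel (u v : word) : bool := `[< pres_eq u v >].

Lemma pres_rel_equiv : equiv_class_of pres_rel.
Proof.
split=> [u|u v|v u w]; rewrite /pres_rel.
- exact/asboolP/pres_refl.
- by apply/asbool_equiv_eq; split; exact: pres_sym.
- by move=> /asboolP uv /asboolP vw; apply/asboolP/(pres_trans uv vw).
Qed.

Canonical pres_equiv := EquivRelPack pres_rel_equiv.

Definition presented : Type := {eq_quot pres_equiv}.

HB.instance Definition _ := Choice.on presented.
HB.instance Definition _ := EqQuotient.on presented.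

Definition pres_class (u : word) : presented := \pi_presented u.
Definition pres_one : presented := pres_class [::].
Definition pres_mul (a b : presented) : presented := pres_class (repr a ++ repr b).
Definition pres_inv (a : presented) : presented := pres_class (inv_word (repr a)).

Lemma pres_classP u v : pres_class u = pres_class v <-> pres_eq u v.
Proof. by split=> [/eqmodP/asboolP//|uv]; apply/eqmodP/asboolP. Qed.

Lemma pres_class_surj (a : presented) : exists u, a = pres_class u.
Proof. by exists (repr a); rewrite /pres_class reprK. Qed.

Lemma inv_wordK : involutive inv_word.
Proof.
move=> u; rewrite /inv_word map_rev revK -map_comp map_id_in // => -[a b] _.
by rewrite /= /inv_letter /= negbK.
Qed.

Lemma pres_mul_invr u : pres_eq (u ++ inv_word u) [::].
Proof.
elim: u => [|l u IHu]; first exact: pres_refl.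
rewrite /inv_word map_cons rev_cons -cats1 catA cat_cons -cat1s -catA.
apply: pres_trans (pres_cancel l).
exact: (pres_cat (pres_refl [:: l]) (pres_cat IHu (pres_refl [:: inv_letter l]))).
Qed.

Lemma pres_mul_invl u : pres_eq (inv_word u ++ u) [::].
Proof. by have := pres_mul_invr (inv_word u); rewrite inv_wordK. Qed.

Lemma pres_eq_inv u v : pres_eq u v -> pres_eq (inv_word u) (inv_word v).
Proof.
move=> uv; have uVv : pres_eq (inv_word u ++ v) [::].
  apply: pres_trans (pres_mul_invl u).
  exact: pres_cat (pres_refl _) (pres_sym uv).
have h1 := pres_cat uVv (pres_refl (inv_word v)).
apply: pres_trans h1; rewrite -catA -[X in pres_eq X _]cats0.
exact: pres_cat (pres_refl _) (pres_sym (pres_mul_invr v)).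
Qed.

Lemma repr_pres_class u : pres_eq (repr (pres_class u)) u.
Proof. by apply/pres_classP; rewrite /pres_class reprK. Qed.

Lemma pres_classM u v : pres_mul (pres_class u) (pres_class v) = pres_class (u ++ v).
Proof. by apply/pres_classP/pres_cat; exact: repr_pres_class. Qed.

Lemma pres_classV u : pres_inv (pres_class u) = pres_class (inv_word u).
Proof. exact/pres_classP/pres_eq_inv/repr_pres_class. Qed.

Lemma pres_mulA : associative pres_mul.
Proof.
move=> a b c.
have [u ->] := pres_class_surj a; have [v ->] := pres_class_surj b.
have [w ->] := pres_class_surj c.
by rewrite !pres_classM catA.
Qed.

Lemma pres_mul1 : left_id pres_one pres_mul.
Proof. by move=> a; have [u ->] := pres_class_surj a; rewrite pres_classM. Qed.

Lemma pres_mulr1 : right_id pres_one pres_mul.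
Proof.
by move=> a; have [u ->] := pres_class_surj a; rewrite pres_classM cats0.
Qed.

Lemma pres_mulV : left_inverse pres_one pres_inv pres_mul.
Proof.
move=> a; have [u ->] := pres_class_surj a.
by rewrite pres_classV pres_classM; apply/pres_classP/pres_mul_invl.
Qed.

Lemma pres_mulrV : right_inverse pres_one pres_inv pres_mul.
Proof.
move=> a; have [u ->] := pres_class_surj a.
by rewrite pres_classV pres_classM; apply/pres_classP/pres_mul_invr.
Qed.

HB.instance Definition _ := isGroup.Build presented
  pres_mulA pres_mul1 pres_mulr1 pres_mulV pres_mulrV.

Section UniversalProperty.
Variables (H : groupType) (f : X -> H).

Definition eval_letter (l : X * bool) : H := if l.2 then (f l.1)^-1 else f l.1.
Definition eval_word (u : word) : H := \prod_(l <- u) eval_letter l.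

Lemma eval_pres_eq u v :
  (forall r, R r -> eval_word r = 1) -> pres_eq u v -> eval_word u = eval_word v.
Proof.
move=> fR; elim=> {u v}.
- by [].
- by move=> u v _ ->.
- by move=> u v w _ -> _ ->.
- by move=> u u' v v' _ e1 _ e2; move: e1 e2; rewrite /eval_word !big_cat => -> ->.
- move=> [a b]; rewrite /eval_word !big_cons big_nil mulg1 /eval_letter /=.
  by case: b; rewrite (mulVg, mulgV).
- by move=> r /fR ->; rewrite /eval_word big_nil.
Qed.

Lemma presented_lift : (forall r, R r -> eval_word r = 1) ->
  exists h : presented -> H,
    {morph h : a b / a * b} /\ forall x, h (pres_class [:: (x, false)]) = f x.
Proof.
move=> fR; exists (eval_word \o repr).
have hE u : eval_word (repr (pres_class u)) = eval_word u.
  exact/eval_pres_eq/repr_pres_class.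
split=> [a b|x] /=.
  by rewrite hE /eval_word big_cat.
by rewrite hE /eval_word big_seq1.
Qed.

End UniversalProperty.

End Presentation.

(** The free product of two cyclic groups of order 3; its generators [x] and [y]
    are the letters [true] and [false]. *)
Definition C3C3_relators : set (word bool) :=
  [set nseq 3 (true, false); nseq 3 (false, false)].

Definition C3C3 : Type := presented C3C3_relators.

HB.instance Definition _ := Group.on C3C3.

(* Main.v *)
(** Write [lam n] for the terms of the 3-central series indexed from 0.

    Since [F] is generated by elements of order 3, cubes of elements of [lam c]
    lie in [lam (c + 2)].  Let [F] act on [Z[w]], [w] a primitive cube root of
    unity, so that [x] and [y] act with linear parts [w^-1] and [w] and [xy] is
    the translation by 1.  With [theta = w - 1], so that 3 is associate to
    [theta^2], the image of [lam n] (n > 0) consists of translations by multiples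
    of [theta^n]; comparing with the statement on cubes, [(xy)^i] lies in [lam n]
    as soon as it acts as a translation by a multiple of [theta^n].

    Suppose that [lam n <= N <= lam 3] and that [N] acts by translations by
    multiples of [theta^n].  Then [F/N] is a Beauville group for the pairs
    [(x, y)] and [(x [x,y,y], (y [y,x,x])^-1)].  Indeed the elements of the second
    triple act with nontrivial linear part, hence have trivial cubes, so a power of
    [xy] that is conjugate modulo [N] to a power of one of them lies in [N].  A
    power of [x] and one of [x [x,y,y]] are told apart in [F_3[C_3] : C_3], and
    symmetrically for [y]; the remaining pairs already differ in [F / lam 1].

    The condition on [N] holds for [lam n] (n >= 3), and for every group between
    [lam (n+1)] and the preimage of [theta^(n+1) Z[w]] in [lam n], which has index 3
    in [lam n]; these groups are normal and can be inserted one by one.  For n <= 2,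
    [F / lam n] has exponent 3 and class at most 2: a second generating pair cannot
    lie in the only line of [F / lam 1] missed by the first triple, and outside
    that line every element belongs to [Sigma] of the first pair. *)
From HB Require Import structures.
From mathcomp Require Import all_boot all_algebra zify.
From mathcomp Require Import all_classical.
Require Import Defs.
Set Implicit Arguments.
Unset Strict Implicit.
Unset Printing Implicit Defensive.
Local Open Scope classical_set_scope.
Import GRing.Theory.
Local Open Scope group_scope.
(** * Commutators *)

Section Commutators.
Variable G : groupType.
Implicit Types x y z c d g : G.

Definition central z := forall g, commute z g.

Lemma commMgJ x y z : [~ x * y, z] = [~ x, z] ^ y * [~ y, z].
Proof. by rewrite /commg /conjg !gnorm. Qed.

Lemma commgMJ x y z : [~ x, y * z] = [~ x, z] * [~ x, y] ^ z.
Proof. by rewrite /commg /conjg !gnorm. Qed.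

Lemma commute_conjg c g : commute c g -> c ^ g = c.
Proof. by move=> cg; rewrite conjgE cg mulKg. Qed.

Lemma centralX c n : central c -> central (c ^+ n).
Proof. by move=> Zc g; apply/commute_sym/commuteX/commute_sym. Qed.

Lemma comm_central c g : central c -> [~ c, g] = 1.
Proof. by move=> Zc; apply/eqP/commgP. Qed.

Lemma comm_centralMl c z g : central z -> [~ c * z, g] = [~ c, g].
Proof.
by move=> Zz; rewrite commMgJ (comm_central _ Zz) mulg1 commute_conjg //; exact/commute_sym/Zz.
Qed.

Lemma commg_morph c : (forall g, central [~ c, g]) -> {morph commg c : x y / x * y}.
Proof.
by move=> Zc x y; rewrite commgMJ commute_conjg; apply: Zc.
Qed.

Lemma commg_morphV c x : (forall g, central [~ c, g]) -> [~ c, x^-1] = [~ c, x]^-1.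
Proof. by move=> /commg_morph cM; apply/esym/mulg1_eq; rewrite -cM mulgV commg1. Qed.

(** [[~ c, _]] is a homomorphism with central values, so it agrees on [x * y] and [y * x] and kills
    [[~ x, y]]. *)
Lemma commg_morphR c x y : (forall g, central [~ c, g]) -> [~ c, [~ x, y]] = 1.
Proof.
move=> /[dup] Zc /commg_morph cM; have := cM (y * x) [~ x, y].
by rewrite -commgC !cM (Zc x _) -[LHS]mulg1 => /mulgI.
Qed.

Lemma commg_morphX c x n : (forall g, central [~ c, g]) -> [~ c, x ^+ n] = [~ c, x] ^+ n.
Proof.
move=> /commg_morph cM; elim: n => [|n IHn]; first by rewrite commg1.
by rewrite !expgS cM IHn.
Qed.

Lemma commg_powers x y m n : central [~ x, y] -> [~ x ^+ m, y ^+ n] = [~ x, y] ^+ (m * n).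
Proof.
move=> Zxy.
have cX : [~ x ^+ m, y] = [~ x, y] ^+ m.
  elim: m => [|k IHk]; first by rewrite comm1g.
  by rewrite !expgS commMgJ IHk commute_conjg.
have ZX : central [~ x ^+ m, y] by rewrite cX; exact: centralX.
elim: n => [|k IHk]; first by rewrite muln0 commg1.
by rewrite expgS commgMJ IHk commute_conjg // cX mulnS addnC expgnDr.
Qed.

(** Sorting [x y x y x y] into [x^3 y^3] takes three swaps of adjacent letters, each costing the
    same central factor [[~ x, y]^-1]; the three factors cancel. *)
Lemma cube_mul x y : central [~ x, y] -> [~ x, y] ^+ 3 = 1 ->
  (x * y) ^+ 3 = x ^+ 3 * y ^+ 3.
Proof.
move=> Zc c3; set c := [~ x, y] in Zc c3.
pose d := c^-1; have Zd g h : g * (d * h) = d * (g * h).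
  by rewrite !mulgA; congr (_ * _); apply/commuteV/commute_sym/Zc.
have yx : y * x = d * (x * y) by rewrite (commgC x) -/c -(Zc (y * x)) /d mulKg.
transitivity (x * ((y * x) * ((y * x) * y))); first by rewrite !expgS expg0 !gnorm.
rewrite yx -!mulgA (Zd x) (Zd y) 2!(Zd x) [y * (x * _)]mulgA yx -!mulgA 2!(Zd x) !mulgA.
have -> : d * d * d = 1 by rewrite -[RHS]invg1 -c3 -expVgn !expgS expg0 mulg1 mulgA.
by rewrite mul1g.
Qed.
End Commutators.

(** * Generated subgroups and quotient maps *)

Section SubgroupFacts.
Variable G : groupType.
Implicit Types (A H K : set G) (N : nsubgroup G) (x y g : G).

Lemma subgroupX H x n : is_subgroup H -> H x -> H (x ^+ n).
Proof.
move=> [H1 HM HV] Hx; elim: n => [//|n IHn].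
by rewrite expgS; exact: HM.
Qed.

Lemma subgroupR H x y : is_subgroup H -> H x -> H y -> H [~ x, y].
Proof. by move=> [H1 HM HV] Hx Hy; apply: (HM _ _ (HV _ Hx)); apply: (HM _ _ (HV _ Hy)); exact: HM. Qed.

Lemma gen_min A H : is_subgroup H -> A `<=` H -> gen A `<=` H.
Proof. by move=> sH AH x Ax; exact: Ax. Qed.

Lemma subset_gen A K : A `<=` K -> gen A `<=` gen K.
Proof. by move=> AK; apply: gen_min (subgroup_gen K) _ => x /AK; exact: sub_gen. Qed.

(** Finite order makes natural exponents suffice: the inverse of [x ^+ n] is [x ^+ (n * e)]. *)
Lemma gen1P e x y : x ^+ e.+1 = 1 -> gen [set x] y -> exists n, y = x ^+ n.
Proof.
move=> xe; apply: (@gen_min _ [set y | exists n, y = x ^+ n]); last first.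
  by move=> _ ->; exists 1%N.
split=> [|_ _ [m ->] [n ->]|_ [n ->]]; first by exists 0%N.
  by exists (m + n)%N; rewrite expgnDr.
exists (n * e)%N; apply/mulg1_eq.
by rewrite -expgnDr -mulnS mulnC expgnA xe expg1n.
Qed.

Lemma gen1X x n : gen [set x] (x ^+ n).
Proof. exact: (subgroupX n (subgroup_gen [set x]) (sub_gen (erefl x))). Qed.

Lemma nsubgroup_inj N N' : N = N' :> set G -> N = N'.
Proof.
case: N N' => [N nN] [N' nN'] /= eN; case: _ / eN nN' => nN'.
by congr NSubgroup; exact: Prop_irrelevance.
Qed.

Lemma normal_sub N : is_subgroup N. Proof. by case: (nsubgroupP N). Qed.

Lemma normalJ N x g : (N : set G) x -> (N : set G) (x ^ g).
Proof. by case: (nsubgroupP N) => _; exact. Qed.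

End SubgroupFacts.

Lemma cosetg_is_morphism (G : groupType) (N : nsubgroup G) :
  {morph cosetg N : x y / x * y}.
Proof. by move=> x y; exact/esym/cosetgM. Qed.

HB.instance Definition _ (G : groupType) (N : nsubgroup G) :=
  isUMagmaMorphism.Build G (quotg N) (cosetg N) (erefl, @cosetg_is_morphism G N).

Lemma cosetg_eq1 (G : groupType) (N : nsubgroup G) g :
  cosetg N g = 1 <-> (N : set G) g.
Proof.
have [_ _ NV] := normal_sub N.
rewrite -[1]/(cosetg N 1) cosetgP mulg1; split=> /NV //.
by rewrite invgK.
Qed.


(** * The 3-central series: commutators and cubes *)

Section PCentralSeries.
Variable G : groupType.
Implicit Types (H K : set G) (N : nsubgroup G) (a c g : G).

Definition lam (i : nat) : nsubgroup G := pcentral G 3 i.+1.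

Lemma lam0 g : (lam 0 : set G) g. Proof. by []. Qed.

Lemma lam_min i H : is_subgroup H ->
  (forall a g, (lam i : set G) a -> H [~ a, g]) ->
  (forall a, (lam i : set G) a -> H (a ^+ 3)) -> (lam i.+1 : set G) `<=` H.
Proof.
move=> sH HR HX _ [c Hc [d Hd <-]]; have [_ HM _] := sH; apply: HM.
  by move: Hc; apply: gen_min => // _ [a la [g _ <-]]; exact: HR.
by move: Hd; apply: gen_min => // _ [a la <-]; exact: HX.
Qed.

Lemma lamR i a g : (lam i : set G) a -> (lam i.+1 : set G) [~ a, g].
Proof.
move=> la; exists [~ a, g]; first by apply: sub_gen; exists a => //; exists g.
exists 1; last by rewrite mulg1.
by have [] := subgroup_gen [set b ^+ 3 | b in lam i : set G].
Qed.

Lemma lamX i a : (lam i : set G) a -> (lam i.+1 : set G) (a ^+ 3).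
Proof.
move=> la; exists 1; first by have [] := subgroup_gen [set [~ a, b] | a in (lam i : set G) & b in setT].
by exists (a ^+ 3); [apply: sub_gen; exists a | rewrite mul1g].
Qed.

Lemma lamS i : (lam i.+1 : set G) `<=` lam i.
Proof.
apply: lam_min (normal_sub _) _ _ => [a g la|a la]; last exact: subgroupX (normal_sub _) la.
rewrite commgEl; have [_ lM lV] := normal_sub (lam i).
by apply: lM; [exact: lV | exact: normalJ].
Qed.

Lemma lam_le i j : (i <= j)%N -> (lam j : set G) `<=` lam i.
Proof.
move=> /subnK <-; elim: (j - i)%N => [//|k IHk] g /lamS; exact: IHk.
Qed.

Lemma central_cosetg N c : (forall g, (N : set G) [~ c, g]) -> central (cosetg N c).
Proof.
move=> Nc a; have [g ->] := cosetg_surj a.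
by apply/commgP/eqP; rewrite -gmulfR; apply/cosetg_eq1.
Qed.

Lemma lam_central i c : (lam i : set G) c -> central (cosetg (lam i.+1) c).
Proof. by move=> lc; apply: central_cosetg => g; exact: lamR. Qed.

Lemma lam_cube i c : (lam i : set G) c -> cosetg (lam i.+1) c ^+ 3 = 1.
Proof. by move=> lc; rewrite -gmulfXn; apply/cosetg_eq1; exact: lamX. Qed.

(** Modulo [lam i.+2], the map [[~ c, _]] is a homomorphism into central elements of order dividing
    3. It kills commutators and cubes, hence [lam 1]. *)
Lemma comm_lam1 i c a : (lam i : set G) c -> (lam 1 : set G) a -> (lam i.+2 : set G) [~ c, a].
Proof.
move=> lc; pose p := cosetg (lam i.+2).
have Zc b : central [~ p c, b].
  by have [g ->] := cosetg_surj b; rewrite /p -gmulfR; apply/lam_central/lamR.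
pose H := [set a | [~ p c, p a] = 1].
have sH : is_subgroup H.
  split=> [|g h|g]; rewrite /H /= /p ?gmulf1 ?commg1 ?gmulfM ?gmulfV //.
    by move=> Hg Hh; rewrite commg_morph // Hg Hh mulg1.
  by move=> /eqP/commgP/commuteV/commgP/eqP.
suff: (lam 1 : set G) `<=` H by move=> /[apply]; rewrite /H /= /p -gmulfR => /cosetg_eq1.
apply: lam_min => // [b g _|b _]; rewrite /H /= /p.
  by rewrite gmulfR commg_morphR.
by rewrite gmulfXn commg_morphX // -gmulfR lam_cube //; exact: lamR.
Qed.

(** By [comm_lam1], elements of [lam i.+1] commute modulo [lam i.+3], so those with trivial cube
    there form a subgroup. It remains to treat the generators [[~ g, f]] and [g ^+ 3] with [g] in
    [lam i]. *)
Lemma cube_lam i c : (forall g, (lam 2 : set G) (g ^+ 3)) ->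
  (lam i : set G) c -> (lam i.+2 : set G) (c ^+ 3).
Proof.
move=> X2; elim: i c => [|i IHi] c; first by move=> _; exact: X2.
pose p := cosetg (lam i.+3); pose H := [set c | (lam i.+1 : set G) c /\ p c ^+ 3 = 1].
have [l1 lM lV] := normal_sub (lam i.+1).
suff: (lam i.+1 : set G) `<=` H.
  by move=> /[apply] -[_]; rewrite /p -gmulfXn => /cosetg_eq1.
have sH : is_subgroup H.
  split=> [|g h [lg Hg] [lh Hh]|g [lg Hg]]; split; rewrite /p ?gmulf1 ?expg1n //.
  - exact: lM.
  - rewrite gmulfM expgMn ?Hg ?Hh ?mulg1 //; apply/commgP/eqP; rewrite -gmulfR.
    by apply/cosetg_eq1/comm_lam1 => //; exact: (@lam_le 1 i.+1).
  - exact: lV.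
  - by rewrite gmulfV expVgn Hg invg1.
apply: lam_min => // [g f lg|g lg]; split; try exact: lamR; try exact: lamX.
  set d := [~ g, f]; have lR : (lam i.+2 : set G) [~ g, d].
    by rewrite -invgR; have [_ _ ] := normal_sub (lam i.+2); apply; exact/lamR/lamR.
  have gd3 : (p g * p d) ^+ 3 = p g ^+ 3 * p d ^+ 3.
    by apply: cube_mul; rewrite /p -gmulfR; [exact: lam_central | exact: lam_cube].
  (* Here [g * d] is [g ^ f], and [g ^+ 3] is central modulo [lam i.+3] by induction, so conjugating
     it by [f] changes nothing. Comparison with [gd3] leaves [d ^+ 3 = 1]. *)
  have gf3 : p g ^+ 3 = (p g * p d) ^+ 3.
    rewrite /p -gmulfM /d commgEl mulVKg gmulfJ -conjXg -gmulfXn commute_conjg //.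
    exact/lam_central/IHi.
  by apply: (mulgI (p g ^+ 3)); rewrite -gd3 -gf3 mulg1.
by rewrite /p -gmulfXn; apply/cosetg_eq1/lamX/IHi.
Qed.

End PCentralSeries.

(** * Finiteness of the 3-central quotients *)

Section FinitePQuotients.
Variable G : groupType.
Implicit Types (H K : set G) (N : nsubgroup G) (a c g : G).

Lemma repr_cosetg N g : (N : set G) ((repr (cosetg N g))^-1 * g).
Proof. by apply/cosetgP; rewrite /cosetg reprK. Qed.

Lemma cosetg_eqr N g h : (N : set G) (h^-1 * g) -> exists2 z, (N : set G) z & g = h * z.
Proof. by move=> Nhg; exists (h^-1 * g) => //; rewrite mulVKg. Qed.

(** Modulo [lam k.+2], a commutator [[~ a, g]] with [a] in [lam k] depends only on [a] modulo
    [lam k.+1] and [g] modulo [lam 1], and [a ^+ 3] only on [a] modulo [lam k.+1]. Hence [a] and [g]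
    may be replaced by elements of [H]. *)
Lemma frattini_lam k H : is_subgroup H ->
  (forall g, exists2 h, H h & (lam G 1 : set G) (h^-1 * g)) ->
  forall c, (lam G k : set G) c ->
    exists h, [/\ H h, (lam G k : set G) h & (lam G k.+1 : set G) (h^-1 * c)].
Proof.
move=> sH H1; have [H_1 HM HV] := sH.
elim: k => [|k IHk] c; first by move=> _; have [h Hh hc] := H1 c; exists h.
pose p := cosetg (lam G k.+2).
pose E := [set c | exists h, [/\ H h, (lam G k.+1 : set G) h & p h = p c]].
suff: (lam G k.+1 : set G) `<=` E.
  by move=> /[apply] -[h [Hh lh /cosetgP hc]]; exists h.
have [l1 lM lV] := normal_sub (lam G k.+1).
have sE : is_subgroup E.
  split=> [|g f [g' [Hg lg pg]] [f' [Hf lf pf]]|g [g' [Hg lg pg]]].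
  - by exists 1.
  - by exists (g' * f'); split; [exact: HM | exact: lM | rewrite /p !gmulfM; congr (_ * _)].
  - by exists g'^-1; split; [exact: HV | exact: lV | rewrite /p !gmulfV; congr (_^-1)].
apply: lam_min => // [a g la|a la].
  have [h [Hh lh /cosetg_eqr[z lz ->]]] := IHk a la; have [f Hf /cosetg_eqr[w lw ->]] := H1 g.
  exists [~ h, f]; split; [exact: subgroupR | exact: lamR | rewrite /p].
  rewrite !gmulfR !gmulfM comm_centralMl; last exact: lam_central.
  rewrite commgMJ -!gmulfR /=; have /cosetg_eq1-> := comm_lam1 lh lw.
  by rewrite mul1g commute_conjg //; exact/lam_central/lamR.
have [h [Hh lh /cosetg_eqr[z lz ->]]] := IHk a la.
exists (h ^+ 3); split; [exact: subgroupX | exact: lamX | rewrite /p].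
rewrite !gmulfXn gmulfM expgMn; last by apply/commute_sym/(lam_central lz).
by rewrite (lam_cube lz) mulg1.
Qed.

(** [lam 1] plays the part of the Frattini subgroup: an approximation of [g] in [H] modulo [lam k]
    is corrected, one term at a time, by [frattini_lam]. *)
Lemma frattini_sup k H : is_subgroup H ->
  (forall g, exists2 h, H h & (lam G 1 : set G) (h^-1 * g)) ->
  (lam G k : set G) `<=` H -> H = setT.
Proof.
move=> sH H1 lH; have [H_1 HM HV] := sH; apply/seteqP; split=> // g _.
suff [h Hh hg] : exists2 h, H h & (lam G k : set G) (h^-1 * g).
  by rewrite -[g](mulVKg h); exact/HM/lH.
elim: k {lH} => [|k [h Hh hg]]; first by exists 1.
have [f [Hf lf hfg]] := frattini_lam sH H1 hg.
by exists (h * f); [exact: HM | rewrite invgM -mulgA].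
Qed.

Lemma finite_gen_central (Q : groupType) (s : seq Q) :
  (forall q, q \in s -> central q /\ q ^+ 3 = 1) -> finite_set (gen [set` s]).
Proof.
elim: s => [|q s IHs] Zs.
  apply: (@sub_finite_set _ _ [set 1]); last exact: finite_set1.
  by apply: gen_min => //; split=> [//|_ _ -> ->|_ ->]; rewrite /= ?mulg1 ?invg1.
have [Zq q3] := Zs q (mem_head _ _).
have {IHs} fs := IHs (fun r rs => Zs r (mem_behead (s := q :: s) rs)).
apply: (@sub_finite_set _ _ [set a * q ^+ i | a in gen [set` s] & i in `I_3]); last first.
  exact: finite_image2.
have [g1 gM gV] := subgroup_gen [set` s].
have qm i : q ^+ i = q ^+ (i %% 3)%N.
  by rewrite {1}(divn_eq i 3) expgnDr mulnC expgnA q3 expg1n mul1g.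
apply: gen_min; last first.
  move=> r /=; rewrite inE => /orP[/eqP->|rs]; first by exists 1 => //; exists 1%N; rewrite ?mul1g.
  by exists r; [exact: sub_gen | exists 0%N; rewrite ?mulg1].
split; first by exists 1 => //; exists 0%N; rewrite ?mulg1.
- move=> _ _ [a ga [i _ <-]] [b gb [j _ <-]]; exists (a * b); first exact: gM.
  exists ((i + j) %% 3)%N; first by rewrite /= ltn_mod.
  by rewrite -qm expgnDr !mulgA; congr (_ * _); rewrite -!mulgA; congr (_ * _); exact/commute_sym/centralX.
- move=> _ [a ga [i _ <-]]; exists a^-1; first exact: gV.
  exists (i * 2 %% 3)%N; first by rewrite /= ltn_mod.
  rewrite -qm invgM; have -> : q ^- i = q ^+ (i * 2).
    by apply: mulg1_eq; rewrite -expgnDr -mulnS mulnC expgnA q3 expg1n.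
  by apply: commute_sym; exact: centralX.
Qed.

(** The next factor is generated by the central classes of [[~ t, x]] and [t ^+ 3], of order
    dividing 3, where [t] runs over representatives of the previous finite factor and [x] over the
    generators [s]. *)
Lemma finite_lam_factor k (s : seq G) : gen [set` s] = setT ->
  finite_set (cosetg (lam G k.+1) @` lam G k).
Proof.
move=> Gs; elim: k => [|k /finite_seqP[qs eqs]].
  pose p := cosetg (lam G 1).
  have fS : finite_set (gen [set` map p s]).
    apply: finite_gen_central => _ /mapP[x _ ->].
    by split; [exact: (lam_central (lam0 x)) | exact: (lam_cube (lam0 x))].
  apply: sub_finite_set fS => _ [c _ <-]; have [g1 gM gV] := subgroup_gen [set` map p s].
  have : gen [set` s] c by rewrite Gs.
  apply: (@gen_min _ _ [set c | gen [set` map p s] (p c)]) => [|x /= xs].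
    split=> [|a b ga gb|a ga] /=; rewrite /p ?gmulf1 ?gmulfM ?gmulfV //; first exact: gM.
    exact: gV.
  by apply: sub_gen; exact: map_f.
pose p := cosetg (lam G k.+2).
pose T := map repr qs.
have lT t : t \in T -> (lam G k : set G) t.
  move=> /mapP[q]; have [_ lM lV] := normal_sub (lam G k).
  move=> qqs ->; have : [set` qs] q by []. rewrite -eqs => -[c lc <-].
  have := lV _ (lamS (repr_cosetg (lam G k.+1) c)); rewrite invgM invgK => lc'.
  by rewrite -[repr _](mulKg c^-1) invgK; exact: lM.
pose S := [seq p [~ t, x] | t <- T, x <- s] ++ [seq p (t ^+ 3) | t <- T].
have fS : finite_set (gen [set` S]).
  apply: finite_gen_central => q; rewrite mem_cat.
  case/orP=> [/allpairsP[[t x] /= [/lT lt xs ->]]|/mapP[t /lT lt ->]].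
    by split; [exact/lam_central/lamR | exact/lam_cube/lamR].
  by split; [exact/lam_central/lamX | exact/lam_cube/lamX].
apply: sub_finite_set fS => _ [c + <-].
have [g1 gM gV] := subgroup_gen [set` S].
have sS : is_subgroup [set c | gen [set` S] (p c)].
  split=> [|a b ga gb|a ga] /=; rewrite /p ?gmulf1 ?gmulfM ?gmulfV //; first exact: gM.
  exact: gV.
move: c; apply: (lam_min sS) => [a g la|a la] /=.
all: have [t tT /cosetg_eqr[z lz ->]] : exists2 t, t \in T & (lam G k.+1 : set G) (t^-1 * a).
all: try (exists (repr (cosetg (lam G k.+1) a)); last exact: repr_cosetg).
all: try (by apply: map_f; have : [set` qs] (cosetg (lam G k.+1) a) by rewrite -eqs; exists a).
  have lt := lT _ tT; rewrite /p gmulfR gmulfM comm_centralMl; last exact: lam_central.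
  rewrite -gmulfR /=; have : gen [set` s] g by rewrite Gs.
  have sS' : is_subgroup [set g | gen [set` S] (p [~ t, g])].
    have Zt b : central [~ p t, b].
      by have [f ->] := cosetg_surj b; rewrite /p -gmulfR; exact/lam_central/lamR.
    split=> [|b f gb gf|b gb] /=; first by rewrite /p commg1 gmulf1.
      by rewrite /p gmulfR gmulfM commg_morph // -!gmulfR; exact: gM.
    by rewrite /p gmulfR gmulfV commg_morphV // -gmulfR; exact: gV.
  apply: (gen_min sS') => x /= xs; apply: sub_gen; rewrite /S /= mem_cat.
  by apply/orP; left; apply/allpairsP; exists (t, x).
rewrite /p gmulfXn gmulfM expgMn; last by apply/commute_sym/(lam_central lz).
rewrite (lam_cube lz) mulg1 -gmulfXn /=; apply: sub_gen; rewrite /S /= mem_cat.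
by apply/orP; right; apply: map_f.
Qed.

Lemma finite_pquotient k N (s : seq G) : gen [set` s] = setT ->
  (lam G k : set G) `<=` N -> finite_set [set: quotg N].
Proof.
move=> Gs lN; have fin i : finite_set [set: quotg (lam G i)].
  elim: i => [|i fi].
    apply: (@sub_finite_set _ _ [set 1]); last exact: finite_set1.
    by move=> q _; have [g ->] := cosetg_surj q; apply/cosetg_eq1.
  have := finite_image2 (fun q r => cosetg (lam G i.+1) (repr q) * r) fi
    (finite_lam_factor i Gs).
  apply: sub_finite_set => q _; have [g ->] := cosetg_surj q.
  exists (cosetg (lam G i) g) => //.
  set t := repr _; exists (cosetg (lam G i.+1) (t^-1 * g)).
    by exists (t^-1 * g) => //; exact: repr_cosetg.
  by rewrite -gmulfM mulVKg.
have := finite_image (fun q => cosetg N (repr q)) (fin k).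
apply: sub_finite_set => q _; have [g ->] := cosetg_surj q.
exists (cosetg (lam G k) g) => //; apply/cosetgP/lN; exact: repr_cosetg.
Qed.

End FinitePQuotients.

(** * Groups of exponent 3 and class 2 *)

Section ExponentThree.
Variable G : groupType.
Hypotheses (expG : forall g : G, g ^+ 3 = 1) (ZG : forall a b : G, central [~ a, b]).

Lemma exp3_mod (g : G) n : g ^+ n = g ^+ (n %% 3)%N.
Proof. by rewrite {1}(divn_eq n 3) expgnDr mulnC expgnA expG expg1n mul1g. Qed.

Lemma exp3_cyclic (g : G) : gen [set g] = setT -> ~ min_generators G 2.
Proof.
move=> gG [_ /(_ [:: g])]; rewrite (_ : [set` [:: g]] = [set g]).
  by move=> /(_ gG).
by apply/seteqP; split=> x; rewrite /= inE => /eqP.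
Qed.

(** Moving a power of [x] to the left of a power of [y] costs only a power of the central [z].
    Inverses reduce to products, since [g^-1 = g * g] in exponent 3. *)
Lemma exp3_normal_form (x y : G) : gen [set x; y] = setT ->
  forall v, exists a b c, v = x ^+ a * y ^+ b * [~ x, y] ^+ c.
Proof.
move=> xyG v; have : gen [set x; y] v by rewrite xyG.
set z := [~ x, y]; have Zz : central z by exact: ZG.
apply: (@gen_min _ _ [set g | exists a b c, g = x ^+ a * y ^+ b * z ^+ c]); last first.
  move=> _ [] ->; first by exists 1%N, 0%N, 0%N; rewrite !mulg1.
  by exists 0%N, 1%N, 0%N; rewrite mulg1 mul1g.
have sM (g h : G) : (exists a b c, g = x ^+ a * y ^+ b * z ^+ c) ->
  (exists a b c, h = x ^+ a * y ^+ b * z ^+ c) -> exists a b c, g * h = x ^+ a * y ^+ b * z ^+ c.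
  move=> [a [b [c ->]]] [d [e [f ->]]].
  have yx : y ^+ b * x ^+ d = x ^+ d * y ^+ b * z ^+ (2 * (b * d)).
    rewrite (commgC (y ^+ b)) commg_powers; last exact: ZG.
    by rewrite -invgR -/z (expgnA _ 2) (_ : z ^+ 2 = z^-1) //; apply/esym/mulg1_eq; rewrite -expgS.
  have ZX k u : u * z ^+ k = z ^+ k * u by apply/commute_sym/centralX.
  move: (2 * (b * d))%N yx => m yx; exists (a + d)%N, (b + e)%N, (m + c + f)%N.
  transitivity (x ^+ a * (y ^+ b * x ^+ d) * y ^+ e * z ^+ c * z ^+ f).
    by rewrite -(mulgA (x ^+ a * y ^+ b)) [z ^+ c * _]mulgA -(ZX c (x ^+ d * _)) !mulgA.
  rewrite yx !expgnDr !mulgA.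
  by rewrite -[_ * _ * y ^+ e in LHS]mulgA -ZX !mulgA.
split=> [|g' h|g' gH]; [by exists 0%N, 0%N, 0%N; rewrite !mulg1 | exact: sM |].
have -> : g'^-1 = g' * g'.
  by apply: mulg1_eq; rewrite -(expG g') !expgS expg0 mulg1.
exact: sM.
Qed.

(** Conjugating [u ^+ a] by [w ^+ (a * c)] multiplies it by [[~ u, w] ^+ (a * a * c)], and [a * a]
    is 1 modulo 3. *)
Lemma Sigma_exp3 (x y u w : G) a c : [\/ u = x, u = y | u = x * y] ->
  [~ u, w] = [~ x, y] -> (a %% 3 != 0)%N -> Sigma x y (u ^+ a * [~ x, y] ^+ c).
Proof.
move=> uxy uw a3; set z := [~ x, y].
have -> : u ^+ a * z ^+ c = (u ^+ a) ^ (w ^+ (a * c)).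
  have -> : (u ^+ a) ^ (w ^+ (a * c)) = u ^+ a * [~ u ^+ a, w ^+ (a * c)].
    by rewrite commgEl mulVKg.
  rewrite commg_powers ?uw; last exact: ZG.
  congr (_ * _); rewrite [LHS]exp3_mod [RHS]exp3_mod mulnA -modnMml -(modnMm a a).
  suff -> : ((a %% 3) * (a %% 3) %% 3)%N = 1%N by rewrite mul1n.
  by move: (a %% 3)%N (ltn_mod a 3) a3 => [|[|[]]].
exists (w ^+ (a * c)) => //.
have ua : forall A : set G, A = [set u] -> conj_set (gen A) (w ^+ (a * c)) (u ^+ a ^ w ^+ (a * c)).
  by move=> A ->; exists (u ^+ a) => //; exact: gen1X.
by case: uxy => eu; [left; left | left; right | right]; apply: ua; rewrite eu.
Qed.

Lemma expg2_mul (x y : G) : (x * y) ^+ 2 = x ^+ 2 * y ^+ 2 * [~ y, x].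
Proof.
have Zk : [~ y, x] * y = y * [~ y, x] by exact: ZG.
transitivity (x * (y * x) * y); first by rewrite expg2 !mulgA.
move: (commgC y x) Zk; move: [~ y, x] => k -> Zk.
by rewrite !expg2 -!mulgA Zk.
Qed.

(** The exponent pairs modulo 3 fill the four lines of the plane over [F_3], those of [x], [y],
    [x * y] and [x * y ^+ 2]. [Sigma x y] covers the first three away from the origin. *)
Lemma Sigma_exp3_dichotomy (x y v : G) : gen [set x; y] = setT ->
  Sigma x y v \/ exists k c, v = (x * y ^+ 2) ^+ k * [~ x, y] ^+ c.
Proof.
move=> /exp3_normal_form/(_ v)[a [b [c ->]]]; set z := [~ x, y].
have yx : [~ y, x] = z ^+ 2.
  by rewrite -invgR; apply/mulg1_eq; rewrite -expgS expG.
rewrite (exp3_mod x) (exp3_mod y).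
move: (a %% 3)%N (b %% 3)%N (ltn_mod a 3) (ltn_mod b 3) => {}a {}b.
have Sx e d : (e %% 3 != 0)%N -> Sigma x y (x ^+ e * z ^+ d).
  by apply: (Sigma_exp3 (w := y)); first by constructor.
have Sy e d : (e %% 3 != 0)%N -> Sigma x y (y ^+ e * z ^+ d).
  apply: (Sigma_exp3 (w := x^-1)); first by constructor.
  by rewrite commg_morphV // invgR.
have Sxy e d : (e %% 3 != 0)%N -> Sigma x y ((x * y) ^+ e * z ^+ d).
  apply: (Sigma_exp3 (w := y)); first by constructor.
  by rewrite commMgJ commgg mulg1 commute_conjg //; exact: ZG.
case: a => [|[|[|//]]]; case: b => [|[|[|//]]] _ _.
- by right; exists 0%N, c; rewrite mulg1.
- by left; rewrite mul1g; apply: Sy.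
- by left; rewrite mul1g; apply: Sy.
- by left; rewrite mulg1; apply: Sx.
- by left; rewrite -[x ^+ 1 * _]/((x * y) ^+ 1); apply: Sxy.
- by right; exists 1%N, c.
- by left; rewrite mulg1; apply: Sx.
- right; exists 2%N, (c + 2)%N.
  rewrite expg2_mul (_ : [~ y ^+ 2, x] = [~ y, x] ^+ 2); last exact: (commg_powers 2 1).
  rewrite yx -!expgnA (exp3_mod y (2 * 2)) -[RHS]mulgA -expgnDr; congr (_ * _).
  by rewrite [LHS]exp3_mod [RHS]exp3_mod addnCA -[(2 * 2 + 2)%N]/(2 * 3)%N addnC modnMDl.
- left; have := Sxy 2 (c + 1)%N isT.
  by rewrite expg2_mul yx -[_ * z ^+ (c + 1)]mulgA -expgnDr (exp3_mod z (_ + _)) addnCA modnDr -exp3_mod.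
Qed.

(** The nontrivial [x2] and [y2] must avoid [Sigma x1 y1], so both are powers of one element [w]
    times central factors. Then they commute, [G] is abelian, [z] is trivial and [w] generates
    [G]. *)
Lemma not_beauville_exp3 : ~ beauville G.
Proof.
move=> [_ minG [x1 [y1 [x2 [y2 [g1 g2 S12]]]]]].
have x2N1 : x2 <> 1.
  move=> x21; apply: (exp3_cyclic (g := y2)) => //; apply/seteqP; split=> // g _.
  have : gen [set x2; y2] g by rewrite g2.
  apply: (gen_min (subgroup_gen [set y2])) => _ [] ->; last exact: sub_gen.
  by rewrite x21; case: (subgroup_gen [set y2]).
have y2N1 : y2 <> 1.
  move=> y21; apply: (exp3_cyclic (g := x2)) => //; apply/seteqP; split=> // g _.
  have : gen [set x2; y2] g by rewrite g2.
  apply: (gen_min (subgroup_gen [set x2])) => _ [] ->; first exact: sub_gen.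
  by rewrite y21; case: (subgroup_gen [set x2]).
have S2 v : v = x2 \/ v = y2 -> Sigma x2 y2 v.
  by move=> [] ->; exists 1 => //; left; [left | right]; [exists x2 | exists y2];
    rewrite ?conjg1 //; exact: sub_gen.
have S1 v : Sigma x1 y1 v -> v = x2 \/ v = y2 -> v = 1.
  by move=> S1v /S2 S2v; have : [set 1] v by rewrite -S12.
case: (Sigma_exp3_dichotomy x2 g1) => [/S1 x21|[k [c ex]]]; first by apply/x2N1/x21; left.
case: (Sigma_exp3_dichotomy y2 g1) => [/S1 y21|[l [d ey]]]; first by apply/y2N1/y21; right.
set w := x1 * _ in ex ey; set z := [~ x1, y1] in ex ey.
have Zz n : central (z ^+ n) by exact/centralX/ZG.
have c2 : commute x2 y2.
  rewrite ex ey; apply: commuteM; last by apply/commute_sym/Zz.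
  by apply/commute_sym/commuteM; [exact: commuteX2 | apply/commute_sym/Zz].
have G2 (P : set G) : is_subgroup P -> P x2 -> P y2 -> forall g, P g.
  by move=> sP Px Py g; have : gen [set x2; y2] g by [rewrite g2]; apply: gen_min => // _ [] ->.
have sC (h : G) : is_subgroup [set g | commute h g].
  by split=> [|a b|a] /=; [exact: commute1 | exact: commuteM | exact: commuteV].
have ab (g h : G) : commute g h.
  have Cx : commute x2 g := G2 _ (sC x2) (commute_refl x2) c2 g.
  have Cy : commute y2 g := G2 _ (sC y2) (commute_sym c2) (commute_refl y2) g.
  exact: (G2 _ (sC g) (commute_sym Cx) (commute_sym Cy) h).
have z1 : z = 1 by apply/eqP/commgP.
apply: (exp3_cyclic (g := w)) => //; apply/seteqP; split=> // g _; move: g.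
apply: (G2 _ (subgroup_gen [set w])); rewrite ?ex ?ey z1 expg1n mulg1; exact: gen1X.
Qed.
End ExponentThree.

(** * Semidirect products with a group of order 3 *)

Section Semidirect.
Variables (A : zmodType) (t : {additive A -> A}).
Hypothesis t3 : forall a, t (t (t a)) = a.

(* The semidirect product of [A] by the cyclic group of order 3 acting through [t]. *)
Definition sdp of (forall a, t (t (t a)) = a) : Type := (A * 'Z_3)%type.

HB.instance Definition _ := Choice.on (sdp t3).

Implicit Types (a b w : A) (s u : 'Z_3).

Definition sdp_act s a : A := iter (s : nat) t a.
Definition sdp_theta a : A := (t a - a)%R.

Definition sdp_one : sdp t3 := (0, 0)%R.
Definition sdp_mul (p q : sdp t3) : sdp t3 := (p.1 + sdp_act p.2 q.1, p.2 + q.2)%R.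
Definition sdp_inv (p : sdp t3) : sdp t3 := (- sdp_act (- p.2) p.1, - p.2)%R.

Lemma sdp_actD s a b : sdp_act s (a + b)%R = (sdp_act s a + sdp_act s b)%R.
Proof. by rewrite /sdp_act; elim: (s : nat) => [|n IHn] //=; rewrite IHn raddfD. Qed.

Lemma sdp_actN s a : sdp_act s (- a)%R = (- sdp_act s a)%R.
Proof. by rewrite /sdp_act; elim: (s : nat) => [|n IHn] //=; rewrite IHn raddfN. Qed.

Lemma sdp_act_add s u a : sdp_act (s + u)%R a = sdp_act s (sdp_act u a).
Proof.
rewrite /sdp_act; case: s u => [[|[|[|//]]] ?] [[|[|[|//]]] ?] //=; by rewrite ?t3.
Qed.

Lemma sdp_act_theta s n a : sdp_act s (iter n sdp_theta a) = iter n sdp_theta (sdp_act s a).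
Proof.
have tn b : t (iter n sdp_theta b) = iter n sdp_theta (t b).
  by elim: n => //= n IHn; rewrite /sdp_theta raddfB IHn.
by rewrite /sdp_act; elim: (s : nat) => //= m ->; rewrite tn.
Qed.

Lemma sdp_thetaD n a b :
  iter n sdp_theta (a + b)%R = (iter n sdp_theta a + iter n sdp_theta b)%R.
Proof. by elim: n => //= n ->; rewrite /sdp_theta raddfD opprD addrACA. Qed.

Lemma sdp_thetaN n a : iter n sdp_theta (- a)%R = (- iter n sdp_theta a)%R.
Proof. by elim: n => //= n ->; rewrite /sdp_theta raddfN opprB opprK addrC. Qed.

Lemma sdp_theta0 n : iter n sdp_theta 0%R = 0%R.
Proof. by elim: n => //= n ->; rewrite /sdp_theta raddf0 subr0. Qed.

Lemma sdp_thetaMn n a k : iter n sdp_theta (a *+ k)%R = (iter n sdp_theta a *+ k)%R.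
Proof.
by elim: k => [|k IHk]; rewrite ?mulr0n ?sdp_theta0 // !mulrS sdp_thetaD IHk.
Qed.

(** [t^s - 1] is a multiple of [t - 1]. *)
Lemma sdp_act_sub s a : exists w, sdp_act s a = (a + sdp_theta w)%R.
Proof.
rewrite /sdp_act; elim: (s : nat) => [|n [w IHn]] /=.
  by exists 0%R; rewrite /sdp_theta raddf0 subr0 addr0.
exists (a + t w)%R; rewrite IHn raddfD (sdp_thetaD 1 a (t w) : sdp_theta _ = _) /= addrA; congr (_ + _)%R.
  by rewrite /sdp_theta addrC subrK.
by rewrite /sdp_theta raddfB.
Qed.

Lemma sdp_mulA : associative sdp_mul.
Proof.
by move=> p q r; rewrite /sdp_mul /= sdp_actD sdp_act_add !addrA.
Qed.

Lemma sdp_mul1 : left_id sdp_one sdp_mul.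
Proof. by move=> [a s]; rewrite /sdp_mul /= !add0r. Qed.

Lemma sdp_mulr1 : right_id sdp_one sdp_mul.
Proof. by move=> [a s]; rewrite /sdp_mul /= -[X in sdp_act s X](subrr 0%R) sdp_actD sdp_actN subrr !addr0. Qed.

Lemma sdp_mulV : left_inverse sdp_one sdp_inv sdp_mul.
Proof. by move=> [a s]; rewrite /sdp_mul /= !addNr. Qed.

Lemma sdp_mulrV : right_inverse sdp_one sdp_inv sdp_mul.
Proof. by move=> [a s]; rewrite /sdp_mul /= sdp_actN -sdp_act_add !subrr. Qed.

HB.instance Definition _ := isGroup.Build (sdp t3)
  sdp_mulA sdp_mul1 sdp_mulr1 sdp_mulV sdp_mulrV.

Definition sdp0 a : sdp t3 := (a, 0%R).

Lemma sdp0M a b : sdp0 a * sdp0 b = sdp0 (a + b)%R.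
Proof. by congr pair; exact: addr0. Qed.

Lemma sdp0V a : (sdp0 a)^-1 = sdp0 (- a)%R.
Proof. by congr pair; exact: oppr0. Qed.

Lemma sdp0J a (q : sdp t3) : sdp0 a ^ q = sdp0 (sdp_act (- q.2)%R a).
Proof.
case: q => b u; congr pair => /=; last by rewrite add0r addNr.
by rewrite (_ : sdp_act 0%R b = b) // sdp_actD addrCA addNr addr0.
Qed.

Lemma sdp_comm (p q : sdp t3) : [~ p, q] =
  sdp0 (sdp_act (- (q.2 + p.2)) (p.1 + sdp_act p.2 q.1 - (q.1 + sdp_act q.2 p.1)))%R.
Proof.
rewrite (_ : [~ p, q] = (q * p)^-1 * (p * q)); last by rewrite /commg /conjg !gnorm.
case: p q => [a s] [b u]; congr pair => /=; last by rewrite (addrC s) addNr.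
by rewrite [RHS]sdp_actD sdp_actN [RHS]addrC.
Qed.

Lemma sdp_cube (p : sdp t3) :
  p ^+ 3 = sdp0 (p.1 + sdp_act p.2 (p.1 + sdp_act p.2 p.1))%R.
Proof. by case: p => [a s]; congr pair => /=; case: s => [[|[|[|//]]] ?]; apply/val_inj. Qed.

Lemma sdp0X a n : sdp0 a ^+ n = sdp0 (a *+ n)%R.
Proof. by elim: n => [//|n IHn]; rewrite expgS IHn sdp0M mulrS. Qed.

Lemma sdp_sndM (p q : sdp t3) : (p * q).2 = (p.2 + q.2)%R.
Proof. by []. Qed.

Lemma sdp_sndX (p : sdp t3) n : (p ^+ n).2 = (p.2 *+ n)%R.
Proof. by elim: n => [//|n IHn]; rewrite expgS sdp_sndM IHn mulrS. Qed.

Lemma sdp_sndV (p : sdp t3) : (p^-1).2 = (- p.2)%R.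
Proof. by []. Qed.

Lemma sdp_sndJ (p q : sdp t3) : (p ^ q).2 = p.2.
Proof. by rewrite conjgE !sdp_sndM sdp_sndV addrC addrK. Qed.

Lemma sdp_sndR (p q : sdp t3) : [~ p, q].2 = 0%R.
Proof. by rewrite sdp_comm. Qed.

Definition sdp_filter n : set (sdp t3) :=
  [set sdp0 (iter n sdp_theta w) | w in [set: A]].

Lemma subgroup_sdp_filter n : is_subgroup (sdp_filter n).
Proof.
split=> [|_ _ [v _ <-] [w _ <-]|_ [v _ <-]].
- by exists 0%R; rewrite ?sdp_theta0.
- by exists (v + w)%R; rewrite // sdp_thetaD -sdp0M.
- by exists (- v)%R; rewrite // sdp_thetaN -sdp0V.
Qed.

Hypothesis theta3 : forall a, exists w, (a *+ 3)%R = sdp_theta w.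

(** Modulo [theta] the action is trivial, so commutators have zero translation part and the cube of
    an element with translation part [a] has [3 a], which [theta3] puts in the image of [theta].
    Further up the series, commutators with translations and cubes of translations each gain one
    more factor [theta]. *)
Lemma sdp_hom_lam (G : groupType) (h : G -> sdp t3) n : {morph h : x y / x * y} ->
  forall c, (lam G n.+1 : set G) c -> sdp_filter n.+1 (h c).
Proof.
move=> hM; have h1 : h 1 = 1 by apply: (mulgI (h 1)); rewrite -hM !mulg1.
have hV c : h c^-1 = (h c)^-1 by apply/esym/mulg1_eq; rewrite -hM mulgV.
have sH m : is_subgroup [set c | sdp_filter m (h c)].
  have [F1 FM FV] := subgroup_sdp_filter m.
  split=> [|c d Hc Hd|c Hc] /=; [by rewrite h1 | by rewrite hM; exact: FM |].
  by rewrite hV; exact (FV _ Hc).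
have hX c : h (c ^+ 3) = h c ^+ 3 by rewrite !expgS !expg0 !hM h1.
have hR c g : h [~ c, g] = [~ h c, h g] by rewrite /commg /conjg !hM !hV.
elim: n => [|n IHn]; apply: (lam_min (sH _)) => [c g lc|c lc] /=.
- rewrite hR sdp_comm; have [v ->] := sdp_act_sub (h g).2 (h c).1.
  have [w ->] := sdp_act_sub (h c).2 (h g).1; set a := (h c).1; set b := (h g).1.
  have eK (x y z : A) : ((x + y) - (x + z) = y - z)%R by rewrite opprD addrACA subrr add0r.
  rewrite addrCA !eK.
  rewrite -(sdp_thetaN 1) -(sdp_thetaD 1 w) sdp_act_theta.
  by eexists.
- rewrite hX sdp_cube sdp_actD; have [v ev] := sdp_act_sub (h c).2 (h c).1.
  rewrite {2}ev sdp_actD !ev (sdp_act_theta _ 1).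
  set a := (h c).1; set v' := sdp_act _ _; have [u eu] := theta3 a.
  exists (u + (v + (v + v')))%R => //; rewrite !(sdp_thetaD 1) /= -eu mulrS mulr2n -!addrA.
  by rewrite (addrCA (- v)%R a) (addrCA (t v) a).
- have [w _ hc] := IHn c lc.
  have [v wv] := sdp_act_sub (- (h g).2)%R w; exists v => //.
  rewrite hR commgEl -hc sdp0J sdp_act_theta wv sdp_thetaD sdp0V sdp0M addKr.
  by rewrite -iterSr.
- have [w _ hc] := IHn c lc; have [v wv] := theta3 w; exists v => //.
  by rewrite hX -hc expgS expg2 !sdp0M -!sdp_thetaD -mulr2n -mulrS wv -iterSr.
Qed.

End Semidirect.

(** * The free product of two groups of order 3 *)

Section FreeProduct.

Definition cx : C3C3 := pres_class C3C3_relators [:: (true, false)].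
Definition cy : C3C3 := pres_class C3C3_relators [:: (false, false)].

Lemma pres_class_cat (X : choiceType) (R : set (word X)) (u v : word X) :
  (pres_class R (u ++ v) : presented R) = pres_class R u * pres_class R v.
Proof. exact/esym/pres_classM. Qed.

Lemma pres_class_cube (X : choiceType) (R : set (word X)) l :
  (pres_class R [:: l] : presented R) ^+ 3 = pres_class R (nseq 3 l).
Proof.
by rewrite !expgS expg0 mulg1 -(pres_class_cat R [:: l] [:: l]) -(pres_class_cat R [:: l] [:: l; l]).
Qed.

Lemma cx3 : cx ^+ 3 = 1.
Proof. by rewrite [LHS]pres_class_cube; apply/pres_classP/pres_relator; left. Qed.

Lemma cy3 : cy ^+ 3 = 1.
Proof. by rewrite [LHS]pres_class_cube; apply/pres_classP/pres_relator; right. Qed.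

Lemma gen_cxy : gen [set cx; cy] = setT.
Proof.
apply/seteqP; split=> // g _; have [u ->] := pres_class_surj g.
have [g1 gM gV] := subgroup_gen [set cx; cy].
elim: u => [|[b e] u IHu]; first exact: g1.
rewrite -cat1s pres_class_cat; apply: gM => //.
have gb : gen [set cx; cy] (pres_class C3C3_relators [:: (b, false)]).
  by apply: sub_gen; case: b; [left | right].
case: e => //.
suff -> : pres_class C3C3_relators [:: (b, true)] =
          (pres_class C3C3_relators [:: (b, false)] : C3C3)^-1 by exact: gV.
exact/esym/pres_classV.
Qed.

Lemma gen_cxy_ind (H : set C3C3) : is_subgroup H -> H cx -> H cy -> forall g, H g.
Proof.
move=> sH Hx Hy g; have : gen [set cx; cy] g by rewrite gen_cxy.
by apply: (gen_min sH) => _ [] ->.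
Qed.

Lemma C3C3_hom (H : groupType) (a b : H) : a ^+ 3 = 1 -> b ^+ 3 = 1 ->
  exists h : UMagmaMorphism.type C3C3 H, h cx = a /\ h cy = b.
Proof.
move=> a3 b3; have [|h [hM hE]] := @presented_lift bool C3C3_relators H (fun c => if c then a else b).
  by move=> _ [] ->; rewrite /eval_word !big_cons big_nil /eval_letter /= mulg1 ?a3 ?b3.
have h1 : h 1 = 1 by apply: (mulgI (h 1)); rewrite -hM !mulg1.
pose hI := isUMagmaMorphism.Build C3C3 H h (h1, hM).
by exists (HB.pack_for (UMagmaMorphism.type C3C3 H) h hI); split; [exact: (hE true) | exact: (hE false)].
Qed.

(** Modulo [lam 2], commutators are central of order dividing 3, so by [cube_mul] the elements of
    trivial cube form a subgroup; it contains both generators. *)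
Lemma cube_lam2 (g : C3C3) : (lam C3C3 2 : set C3C3) (g ^+ 3).
Proof.
have ZQ (a b : C3C3) : central [~ cosetg (lam C3C3 2) a, cosetg (lam C3C3 2) b].
  by rewrite -gmulfR; exact/lam_central/lamR.
apply/cosetg_eq1; rewrite gmulfXn; move: g.
apply: (gen_cxy_ind (H := [set g | cosetg (lam C3C3 2) g ^+ 3 = 1])) => /=.
- split=> [|a b a3 b3|a a3] /=; first by rewrite gmulf1 expg1n.
    rewrite gmulfM cube_mul ?a3 ?b3 ?mulg1 // -gmulfR.
      exact: (lam_central (lamR b (lam0 a))).
    exact: (lam_cube (lamR b (lam0 a))).
  by rewrite gmulfV expVgn a3 invg1.
- by rewrite -gmulfXn cx3 gmulf1.
- by rewrite -gmulfXn cy3 gmulf1.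
Qed.

Lemma expX_lam (g : C3C3) k : (lam C3C3 k : set C3C3) (g ^+ (3 ^ k)).
Proof. by elim: k => [//|k IHk]; rewrite expnSr expgnA; exact: lamX. Qed.

End FreeProduct.

(* [(a, b)] stands for [a + b w], with [w] a primitive cube root of unity. *)
Definition eis : Type := (int * int)%type.
HB.instance Definition _ := GRing.Zmodule.copy eis (int * int)%type.

Lemma eis_coordB (p q : eis) : (((p - q).1 = p.1 - q.1)%R * ((p - q).2 = p.2 - q.2)%R)%type.
Proof. by []. Qed.

Lemma eis_coordMn (p : eis) n : (((p *+ n).1 = p.1 *+ n)%R * ((p *+ n).2 = p.2 *+ n)%R)%type.
Proof. by elim: n => [//|n IHn]; rewrite !mulrSr -!IHn. Qed.

Lemma eis_eq (p q : eis) : p.1 = q.1 -> p.2 = q.2 -> p = q.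
Proof. by case: p q => a b [c d] /= -> ->. Qed.

(** Multiplication by [w], using [w^2 = -1 - w]. *)
Definition eis_omega (p : eis) : eis := (- p.2, p.1 - p.2)%R.

Lemma eis_omega_zmod : zmod_morphism eis_omega.
Proof. by move=> p q; apply: eis_eq; rewrite eis_coordB /= ?eis_coordB; lia. Qed.

HB.instance Definition _ := GRing.isZmodMorphism.Build eis eis eis_omega eis_omega_zmod.

Lemma eis_omega3 (p : eis) : eis_omega (eis_omega (eis_omega p)) = p.
Proof. by case: p => a b; rewrite /eis_omega /=; congr pair; lia. Qed.

Local Notation eis_theta := (sdp_theta eis_omega).

Lemma eis_theta3 (p : eis) : exists w, (p *+ 3)%R = eis_theta w.
Proof.
(* This is [(-2 - w) p], as [(w - 1)(-2 - w) = 3]. *)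
exists (- 2 * p.1 + p.2, - p.1 - p.2)%R.
by apply: eis_eq; rewrite eis_coordMn /sdp_theta !eis_coordB /=; lia.
Qed.

Lemma eis_theta_sq (p : eis) : exists w, eis_theta (eis_theta p) = (w *+ 3)%R.
Proof.
(* This is [- w p], as [(w - 1)^2 = -3 w]. *)
exists (p.2, p.2 - p.1)%R.
by apply: eis_eq; rewrite eis_coordMn /sdp_theta !eis_coordB /=; lia.
Qed.

Lemma eis_theta_dvd3 (i : nat) w : eis_theta w = (i%:Z, 0)%R -> exists j, i = (j * 3)%N.
Proof.
(* The two coordinates give [a = 2 b] and [i = - 3 b]. *)
case: w => a b /(congr1 (fun p : eis => (p.1, p.2))).
rewrite /sdp_theta !eis_coordB /= => -[e1 e2]; exists `|b|%N; lia.
Qed.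

(** Since [theta^2] is associate to 3 and a cube gains two terms of the series, the induction trades
    two factors [theta] of [i] for one factor 3. A single remaining [theta] still forces 3 to divide
    [i], and one term is gained. *)
Lemma expg_eis_lam m (i c : nat) (w : eis) (g : C3C3) :
  iter m eis_theta w = (i%:Z, 0)%R -> (lam C3C3 c : set C3C3) g ->
  (lam C3C3 (c + m) : set C3C3) (g ^+ i).
Proof.
move: i c w g; elim/ltn_ind: m => -[|[|m]] IHm i c w g.
- by move=> _; rewrite addn0; exact: subgroupX (normal_sub _).
- move=> /eis_theta_dvd3[j ->] lg; rewrite mulnC expgnA; apply: subgroupX (normal_sub _) _.
  by rewrite addn1; exact: lamX.
- move=> /[dup] /eis_theta_dvd3[j ->]; have [v] := eis_theta_sq w.
  rewrite !iterSr => -> e lg; rewrite mulnC expgnA addnS -addSn addnS -addSn.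
  apply: (IHm m _ j _ v) => //; last exact: cube_lam cube_lam2 _.
  move: e; rewrite !mulrSr mulr0n add0r !sdp_thetaD.
  move=> /(congr1 (fun p : eis => (p.1, p.2))) /= -[e1 e2].
  by apply: eis_eq => /=; lia.
Qed.

(* [(a, b, c)] stands for [a + b r + c r^2] in the group algebra over Z/3 of the
   cyclic group generated by [r]. *)
Definition rot : zmodType := ('Z_3 * 'Z_3 * 'Z_3)%type.
Definition rot_shift (p : rot) : rot := (p.2, p.1.1, p.1.2).

Lemma rot_shift_zmod : zmod_morphism rot_shift.
Proof. by move=> [[a b] c] [[d e] f]. Qed.

HB.instance Definition _ := GRing.isZmodMorphism.Build rot rot rot_shift rot_shift_zmod.

Lemma rot_shift3 (p : rot) : rot_shift (rot_shift (rot_shift p)) = p.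
Proof. by case: p => [[a b] c]. Qed.

Local Notation rot_theta := (sdp_theta rot_shift).

Lemma rot_mul3 (p : rot) : (p *+ 3 = 0)%R.
Proof.
by case: p => [[[[|[|[|//]]] ?] [[|[|[|//]]] ?]] [[|[|[|//]]] ?]];
  congr (_, _, _); apply/val_inj.
Qed.

(** [(r - 1)^3 = r^3 - 1 = 0] in characteristic 3. This is why homomorphisms to [rot_group] kill
    [lam 3]. *)
Lemma rot_theta3 (p : rot) : rot_theta (rot_theta (rot_theta p)) = 0%R.
Proof.
by case: p => [[[[|[|[|//]]] ?] [[|[|[|//]]] ?]] [[|[|[|//]]] ?]];
  congr (_, _, _); apply/val_inj.
Qed.

(** * The two Beauville triples *)

Section BeauvilleQuotients.

Definition rot_unit : rot := (1, 0, 0)%R.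
Definition rot_group : groupType := sdp rot_shift3.
Definition eis_group : groupType := sdp eis_omega3.

Lemma rot_theta_mul3 (p : rot) : exists w, (p *+ 3)%R = sdp_theta rot_shift w.
Proof. by exists 0%R; rewrite rot_mul3 [RHS](sdp_theta0 _ 1). Qed.

Lemma rot_hom_lam3 (f : UMagmaMorphism.type C3C3 rot_group) c :
  (lam C3C3 3 : set C3C3) c -> f c = 1.
Proof.
move=> /(sdp_hom_lam rot_theta_mul3 (@gmulfM _ _ f))[w _ <-].
by rewrite [iter 3 _ _]rot_theta3.
Qed.

Lemma snd_hom_lam1 (A : zmodType) (t : {additive A -> A}) (t3 : forall a, t (t (t a)) = a)
  (theta3 : forall a, exists w, (a *+ 3)%R = sdp_theta t w)
  (f : UMagmaMorphism.type C3C3 (sdp t3)) c :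
  (lam C3C3 1 : set C3C3) c -> (f c).2 = 0%R.
Proof. by move=> /(sdp_hom_lam theta3 (@gmulfM _ _ f))[w _ <-]. Qed.

Lemma mulrn_mod3 (V : zmodType) (a : V) (n : nat) : (a *+ 3 = 0 -> a *+ n = a *+ (n %% 3))%R.
Proof. by move=> a3; rewrite {1}(divn_eq n 3) mulrnDr mulnC mulrnA a3 mul0rn add0r. Qed.

Lemma Z3_mul3 (s : 'Z_3) : (s *+ 3 = 0)%R.
Proof. by case: s => [[|[|[|//]]] ?]; apply/val_inj. Qed.

Lemma Z3_mulrn (s : 'Z_3) n : s != 0%R -> (s *+ n)%R = 0%R -> exists k, n = (k * 3)%N.
Proof.
move=> s0; rewrite mulrn_mod3 ?Z3_mul3 // => e; exists (n %/ 3)%N; apply/esym/divnK.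
rewrite /dvdn; move: (n %% 3)%N (ltn_mod n 3) e => [|[|[|//]]] // _.
all: by move: s0; case: s => [[|[|[|//]]] ?].
Qed.

(** The translation part is multiplied by [1 + w^s + w^(2s)], which vanishes for [s] nonzero modulo
    3. *)
Lemma eis_cube (p : eis_group) : p.2 != 0%R -> p ^+ 3 = 1.
Proof.
case: p => [a [[|[|[|//]]] s]] //= _; rewrite sdp_cube; apply: (congr1 (sdp0 _)) => /=.
- by apply: eis_eq => /=; lia.
- by apply: eis_eq => /=; lia.
Qed.

Lemma exists_rot_homs : exists f g : UMagmaMorphism.type C3C3 rot_group,
  [/\ f cx = sdp0 rot_shift3 rot_unit, f cy = (0, 1)%R,
      g cx = (0, 1)%R & g cy = sdp0 rot_shift3 rot_unit].
Proof.
pose r : rot_group := (0, 1)%R; pose e : rot_group := sdp0 rot_shift3 rot_unit.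
have r3 : r ^+ 3 = 1 by rewrite sdp_cube; congr (_, _, _, _); apply/val_inj.
have e3 : e ^+ 3 = 1 by rewrite sdp0X rot_mul3.
have [f [fx fy]] := C3C3_hom e3 r3; have [g [gx gy]] := C3C3_hom r3 e3.
by exists f, g.
Qed.

Lemma exists_eis_hom : exists h : UMagmaMorphism.type C3C3 eis_group,
  [/\ h (cx * cy) = sdp0 eis_omega3 (1, 0)%R, (h cx).2 = (- 1)%R & (h cy).2 = 1%R].
Proof.
(* The translation part [w] of the image of [y] is undone by the rotation [w^-1] of the image of
   [x], so [xy] becomes the translation by 1. *)
pose r : eis_group := (0, - 1)%R; pose e : eis_group := (eis_omega (1, 0)%R, 1)%R.
have r3 : r ^+ 3 = 1 by rewrite sdp_cube.
have e3 : e ^+ 3 = 1 by rewrite sdp_cube.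
have [h [hx hy]] := C3C3_hom r3 e3.
exists h; split; [rewrite gmulfM hx hy | by rewrite hx | by rewrite hy].
by apply: (congr2 (@pair eis 'Z_3)); [exact: eis_eq | exact/val_inj].
Qed.

Section BeauvilleTriples.
Variables (f f' : UMagmaMorphism.type C3C3 rot_group) (h : UMagmaMorphism.type C3C3 eis_group).
Hypotheses (fx : f cx = sdp0 rot_shift3 rot_unit) (fy : f cy = (0, 1)%R).
Hypotheses (f'x : f' cx = (0, 1)%R) (f'y : f' cy = sdp0 rot_shift3 rot_unit).
Hypothesis hxy : h (cx * cy) = sdp0 eis_omega3 (1, 0)%R.
Hypotheses (hx : (h cx).2 = (- 1)%R) (hy : (h cy).2 = 1%R).

(** Modulo [lam 2] the new pair is [cx], [cy^-1]. The inverse puts [cx2 * cy2] on the line of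
    [x y^-1] in [F / lam 1], the one missed by [x], [y] and [xy]. *)
Definition cx2 : C3C3 := cx * [~ cx, cy, cy].
Definition cy2 : C3C3 := (cy * [~ cy, cx, cx])^-1.

Implicit Types (u v g : C3C3) (i j n : nat) (N : nsubgroup C3C3).

Lemma snd_conj_eq (A : zmodType) (t : {additive A -> A}) (t3 : forall a, t (t (t a)) = a)
  (theta3 : forall a, exists w, (a *+ 3)%R = sdp_theta t w)
  (k : UMagmaMorphism.type C3C3 (sdp t3)) u v g i j :
  (lam C3C3 1 : set C3C3) ((v ^+ j)^-1 * (u ^+ i) ^ g) ->
  ((k u).2 *+ i = (k v).2 *+ j)%R.
Proof.
move=> /(snd_hom_lam1 theta3 k).
rewrite gmulfM gmulfV gmulfJ !gmulfXn sdp_sndM sdp_sndV sdp_sndJ !sdp_sndX.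
by rewrite addrC => /eqP; rewrite subr_eq0 => /eqP.
Qed.

(** The linear part under [k] vanishes on [u] but not on [v], so 3 divides [j]; then [k'], which
    detects [u], shows that 3 divides [i]. *)
Lemma separate_snd (k k' : UMagmaMorphism.type C3C3 rot_group) u v g i j :
  (k u).2 = 0%R -> (k v).2 != 0%R -> (k' u).2 != 0%R -> u ^+ 3 = 1 ->
  (lam C3C3 1 : set C3C3) ((v ^+ j)^-1 * (u ^+ i) ^ g) -> u ^+ i = 1.
Proof.
move=> ku kv k'u u3 luv.
have := snd_conj_eq rot_theta_mul3 k luv; rewrite ku mul0rn => /esym /(Z3_mulrn kv)[m ej].
have := snd_conj_eq rot_theta_mul3 k' luv; rewrite ej mulrnA Z3_mul3.
by move=> /(Z3_mulrn k'u)[l ->]; rewrite mulnC expgnA u3 expg1n.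
Qed.

(** A conjugate of [u ^+ i] maps to a multiple of a basis vector, with at least two zero
    coordinates, whereas a nonzero multiple of [(2, 1, 1)] or [(1, 2, 2)] has none. *)
Lemma separate_rot (k : UMagmaMorphism.type C3C3 rot_group) u v g i j (b : bool) :
  k u = sdp0 rot_shift3 rot_unit -> u ^+ 3 = 1 ->
  k v = sdp0 rot_shift3 (if b then (2, 1, 1)%R else (1, 2, 2)%R) ->
  (lam C3C3 3 : set C3C3) ((v ^+ j)^-1 * (u ^+ i) ^ g) -> u ^+ i = 1.
Proof.
move=> ku u3 kv /rot_hom_lam3-/(_ k).
rewrite gmulfM gmulfV gmulfJ !gmulfXn ku kv => /(mulg1_eq (x := _^-1)); rewrite invgK.
rewrite !sdp0X sdp0J => /(congr1 fst) /=.
move: (- (k g).2)%R => s; rewrite (mulrn_mod3 i (rot_mul3 _)) (mulrn_mod3 j (rot_mul3 _)) => e.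
suff: (i %% 3 = 0)%N.
  by move=> i3; rewrite (divn_eq i 3) i3 addn0 mulnC expgnA u3 expg1n.
move: e; move: (i %% 3)%N (j %% 3)%N (ltn_mod i 3) (ltn_mod j 3).
case: b {kv}; case: s => [[|[|[|//]]] ?]; case=> [|[|[|//]]] //; case=> [|[|[|//]]] // _ _.
all: by move=> /(congr1 (fun p : rot => (val p.1.1, val p.1.2, val p.2))).
Qed.

(** The linear part of [xy] is zero and that of [v] is not, so 3 divides [j] and [v ^+ j] acts
    trivially by [eis_cube]. Hence [theta^n] divides a rotation of [i], thus [i] itself, and
    [expg_eis_lam] applies. *)
Lemma separate_eis n N v g i j : (h v).2 != 0%R -> N `<=` (lam C3C3 1 : set C3C3) ->
  (forall c, (N : set C3C3) c -> sdp_filter n (h c)) -> lam C3C3 n `<=` (N : set C3C3) ->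
  (N : set C3C3) ((v ^+ j)^-1 * ((cx * cy) ^+ i) ^ g) -> (N : set C3C3) ((cx * cy) ^+ i).
Proof.
move=> hv N1 hN lN Nuv; apply: lN.
have := snd_conj_eq eis_theta3 h (N1 _ Nuv); rewrite hxy mul0rn.
move=> /esym/(Z3_mulrn hv)[m ej]; have := hN _ Nuv.
rewrite gmulfM gmulfV gmulfJ !gmulfXn hxy ej mulnC expgnA eis_cube // expg1n invg1 mul1g.
rewrite sdp0X sdp0J => -[w _ /(congr1 fst) e].
have e' : iter n (sdp_theta eis_omega) (sdp_act eis_omega (h g).2 w) = (i%:Z, 0)%R.
  rewrite -sdp_act_theta [iter n _ w]e -sdp_act_add; last exact: eis_omega3.
  rewrite addrN; apply: eis_eq; rewrite /sdp_act /= eis_coordMn /=; lia.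
exact: (expg_eis_lam e' (lam0 (cx * cy))).
Qed.

Lemma snd_cx2 (A : zmodType) (t : {additive A -> A}) (t3 : forall a, t (t (t a)) = a)
  (k : UMagmaMorphism.type C3C3 (sdp t3)) : (k cx2).2 = (k cx).2.
Proof. by rewrite /cx2 gmulfM gmulfR sdp_sndM sdp_sndR addr0. Qed.

Lemma snd_cy2 (A : zmodType) (t : {additive A -> A}) (t3 : forall a, t (t (t a)) = a)
  (k : UMagmaMorphism.type C3C3 (sdp t3)) : (k cy2).2 = (- (k cy).2)%R.
Proof. by rewrite /cy2 gmulfV gmulfM gmulfR sdp_sndV sdp_sndM sdp_sndR addr0. Qed.

(** Twofold commutation with [q] acts as [(r^-1 - 1)^2 = 1 + r + r^2] in characteristic 3, so the
    product is [2 + r + r^2]. *)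
Lemma rot_commE (p q : rot_group) : p = sdp0 rot_shift3 rot_unit -> q = (0, 1)%R ->
  p * [~ p, q, q] = sdp0 rot_shift3 (2, 1, 1)%R.
Proof.
by move=> -> ->; rewrite !sdp_comm sdp0M; congr sdp0; congr (_, _, _); apply/val_inj.
Qed.

Lemma rot_cx2 : f cx2 = sdp0 rot_shift3 (2, 1, 1)%R.
Proof. by rewrite /cx2 gmulfM !gmulfR; exact: rot_commE. Qed.

Lemma rot_cy2 : f' cy2 = sdp0 rot_shift3 (1, 2, 2)%R.
Proof.
rewrite /cy2 gmulfV gmulfM !gmulfR [X in X^-1]rot_commE // sdp0V.
by congr sdp0; congr (_, _, _); apply/val_inj.
Qed.

Lemma separate_triples n N u v g i j :
  lam C3C3 n `<=` (N : set C3C3) -> N `<=` (lam C3C3 3 : set C3C3) ->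
  (forall c, (N : set C3C3) c -> sdp_filter n (h c)) ->
  [\/ u = cx, u = cy | u = cx * cy] -> [\/ v = cx2, v = cy2 | v = cx2 * cy2] ->
  (N : set C3C3) ((v ^+ j)^-1 * (u ^+ i) ^ g) -> (N : set C3C3) (u ^+ i).
Proof.
move=> lN N3 hN uE vE Nuv; have [N_1 _ _] := normal_sub N.
have N1 c : (N : set C3C3) c -> (lam C3C3 1 : set C3C3) c by move=> /N3; exact: (@lam_le _ 1 3).
have f'x2 : (f' cx).2 != 0%R by rewrite f'x.
have fy2 : (f cy).2 != 0%R by rewrite fy.
have fx2 : (f cx).2 = 0%R by rewrite fx.
have f'y2 : (f' cy).2 = 0%R by rewrite f'y.
have sx := separate_snd (u := cx) (v := v) (k := f) (k' := f') fx2 _ f'x2 cx3 (N1 _ _).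
have sy := separate_snd (u := cy) (v := v) (k := f') (k' := f) f'y2 _ fy2 cy3 (N1 _ _).
case: uE Nuv => -> Nuv.
- suff -> : cx ^+ i = 1 by [].
  case: vE => ev; rewrite {}ev in Nuv sx.
  + exact: (separate_rot (b := true) fx cx3 rot_cx2 (N3 _ Nuv)).
  + by apply: sx Nuv; rewrite snd_cy2 fy.
  + by apply: sx Nuv; rewrite gmulfM sdp_sndM snd_cx2 snd_cy2 fx fy.
- suff -> : cy ^+ i = 1 by [].
  case: vE => ev; rewrite {}ev in Nuv sy.
  + by apply: sy Nuv; rewrite snd_cx2 f'x.
  + exact: (separate_rot (b := false) f'y cy3 rot_cy2 (N3 _ Nuv)).
  + by apply: sy Nuv; rewrite gmulfM sdp_sndM snd_cx2 snd_cy2 f'x f'y.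
- apply: separate_eis N1 hN lN Nuv.
  case: vE => ->; first by rewrite snd_cx2 hx.
    by rewrite snd_cy2 hy.
  by rewrite gmulfM sdp_sndM snd_cx2 snd_cy2 hx hy.
Qed.

End BeauvilleTriples.

End BeauvilleQuotients.

(** * Generation and the Beauville property of the quotients *)

Section BeauvilleC3C3.
Implicit Types (u v g : C3C3) (N : nsubgroup C3C3).

Lemma preimage_subgroup (G Q : groupType) (p : UMagmaMorphism.type G Q) (H : set Q) :
  is_subgroup H -> is_subgroup [set g | H (p g)].
Proof.
move=> [H1 HM HV]; split=> [|a b|a] /=; first by rewrite gmulf1.
  by rewrite gmulfM; exact: HM.
by rewrite gmulfV; exact: HV.
Qed.

Lemma set_seq2 (T : choiceType) (a b : T) : [set` [:: a; b]] = [set a; b].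
Proof.
apply/seteqP; split=> c /=; rewrite !inE; first by move=> /orP[]/eqP->; [left | right].
by move=> [] ->; rewrite eqxx ?orbT.
Qed.

Lemma gen_coset_cxy N : gen [set cosetg N cx; cosetg N cy] = setT.
Proof.
apply/seteqP; split=> // q _; have [g ->] := cosetg_surj q; move: g.
have sH := preimage_subgroup (cosetg N) (subgroup_gen [set cosetg N cx; cosetg N cy]).
by apply: (gen_cxy_ind sH); apply: sub_gen; [left | right].
Qed.

(** [cx2] and [cy2^-1] agree with [cx] and [cy] modulo [lam 1], so [frattini_sup] applies to the
    preimage of the subgroup they generate. *)
Lemma gen_coset_cxy2 N k : lam C3C3 k `<=` (N : set C3C3) ->
  gen [set cosetg N cx2; cosetg N cy2] = setT.
Proof.
move=> lN; pose H := [set g | gen [set cosetg N cx2; cosetg N cy2] (cosetg N g)].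
have sH : is_subgroup H by exact: (preimage_subgroup (cosetg N) (subgroup_gen _)).
have [H1 HM HV] := sH.
have Hx : H cx2 by apply: sub_gen; left.
have Hy : H cy2 by apply: sub_gen; right.
have [l1 lM lV] := normal_sub (lam C3C3 1).
suff HT : H = setT.
  apply/seteqP; split=> // q _; have [g ->] := cosetg_surj q.
  by have : [set: C3C3] g by []; rewrite -HT.
apply: (frattini_sup (k := k) sH) => [g|g /lN/cosetg_eq1]; last first.
  by rewrite /H /= => ->; have [] := subgroup_gen [set cosetg N cx2; cosetg N cy2].
pose E := [set g | exists2 h, H h & cosetg (lam C3C3 1) h = cosetg (lam C3C3 1) g].
suff [h Hh /cosetgP hg] : E g by exists h.
have sE : is_subgroup E.
  split=> [|a b [c Hc ec] [d Hd ed]|a [c Hc ec]]; first by exists 1.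
    by exists (c * d); [exact: HM | rewrite !gmulfM; congr (_ * _)].
  by exists c^-1; [exact: HV | rewrite !gmulfV; congr (_^-1)].
apply: (gen_cxy_ind sE).
  exists cx2 => //; rewrite /cx2 gmulfM -[RHS]mulg1; congr (_ * _).
  exact/cosetg_eq1/(lamS (i := 1))/lamR/lamR.
exists cy2^-1; first exact: HV.
rewrite /cy2 invgK gmulfM -[RHS]mulg1; congr (_ * _).
exact/cosetg_eq1/(lamS (i := 1))/lamR/lamR.
Qed.

Lemma quotg_finite_order N k (q : quotg N) : lam C3C3 k `<=` (N : set C3C3) ->
  exists e, q ^+ e.+1 = 1.
Proof.
move=> lN; exists (3 ^ k).-1; rewrite prednK ?expn_gt0 //; have [g ->] := cosetg_surj q.
by rewrite -gmulfXn; exact/cosetg_eq1/lN/expX_lam.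
Qed.

(** If one [g] sufficed, [x] and [y] would be powers of [g] modulo [lam 1]. The linear part of [f]
    kills [x] but not [y], so the exponent for [x] is divisible by 3, against the nonzero linear
    part of [f' cx]. *)
Lemma min_generators_quotg N k : lam C3C3 k `<=` (N : set C3C3) ->
  N `<=` (lam C3C3 1 : set C3C3) -> min_generators (quotg N) 2.
Proof.
move=> lN N1; split.
  exists [:: cosetg N cx; cosetg N cy] => //; rewrite -[RHS](gen_coset_cxy N); congr gen.
  exact: set_seq2.
move=> s sT; rewrite leqNgt; apply/negP => s1.
have [a sa] : exists a, [set` s] `<=` [set a].
  case: s s1 {sT} => [|a [|//]] _; first by exists 1.
  by exists a => q /=; rewrite inE => /eqP.
have [g ea] := cosetg_surj a; have [e ae] := quotg_finite_order a lN.
have pow u : exists n, (lam C3C3 1 : set C3C3) ((g ^+ n)^-1 * u).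
  have : gen [set` s] (cosetg N u) by rewrite sT.
  move=> /(subset_gen sa)/(gen1P ae)[n]; rewrite ea -gmulfXn => /esym/cosetgP/N1.
  by exists n.
have [f [f' [fx fy f'x f'y]]] := exists_rot_homs.
have snd_pow (k' : UMagmaMorphism.type C3C3 rot_group) u n :
    (lam C3C3 1 : set C3C3) ((g ^+ n)^-1 * u) -> (k' u).2 = ((k' g).2 *+ n)%R.
  move=> /(snd_hom_lam1 rot_theta_mul3 k'); rewrite gmulfM gmulfV gmulfXn.
  by rewrite sdp_sndM sdp_sndV sdp_sndX addrC => /eqP; rewrite subr_eq0 => /eqP.
have [m lx] := pow cx; have [n ly] := pow cy.
have := snd_pow f cx m lx; have := snd_pow f cy n ly; have := snd_pow f' cx m lx.
rewrite fx fy f'x /= => e1 e2 e3.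
have g2 : (f g).2 != 0%R by apply/eqP => g0; move: e2; rewrite g0 mul0rn.
have [j em] := Z3_mulrn g2 (esym e3).
by move: e1; rewrite em mulnC mulrnA Z3_mul3 mul0rn.
Qed.

Lemma Sigma1 (G : groupType) (x y : G) : Sigma x y 1.
Proof.
exists 1 => //; left; left; exists 1; last by rewrite conj1g.
by have [] := subgroup_gen [set x].
Qed.

Lemma SigmaP N k (x y : C3C3) q : lam C3C3 k `<=` (N : set C3C3) ->
  Sigma (cosetg N x) (cosetg N y) q ->
  exists u i g, [\/ u = x, u = y | u = x * y] /\ q = cosetg N ((u ^+ i) ^ g).
Proof.
move=> lN [b _]; have [g ->] := cosetg_surj b => Sq.
have [u uE [a ua <-]] : exists2 u, [\/ u = x, u = y | u = x * y] &
    conj_set (gen [set cosetg N u]) (cosetg N g) q.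
  case: Sq => [[]|] Sq.
  - by exists x; first constructor 1.
  - by exists y; first constructor 2.
  - by exists (x * y); [constructor 3 | rewrite gmulfM].
have [e ue] := quotg_finite_order (cosetg N u) lN.
have [i ->] := gen1P ue ua.
by exists u, i, g; rewrite gmulfJ gmulfXn.
Qed.

Lemma beauville_quotient (h : UMagmaMorphism.type C3C3 eis_group) n N :
  h (cx * cy) = sdp0 eis_omega3 (1, 0)%R -> (h cx).2 = (- 1)%R -> (h cy).2 = 1%R ->
  lam C3C3 n `<=` (N : set C3C3) -> N `<=` (lam C3C3 3 : set C3C3) ->
  (forall c, (N : set C3C3) c -> sdp_filter n (h c)) -> beauville (quotg N).
Proof.
move=> hxy hx hy lN N3 hN; have [f [f' [fx fy f'x f'y]]] := exists_rot_homs.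
split.
- apply: (finite_pquotient (s := [:: cx; cy]) _ lN).
  rewrite -gen_cxy; congr gen.
  exact: set_seq2.
- by apply: min_generators_quotg lN _ => c /N3; exact: (@lam_le _ 1 3).
- exists (cosetg N cx), (cosetg N cy), (cosetg N cx2), (cosetg N cy2); split.
  + exact: gen_coset_cxy.
  + exact: gen_coset_cxy2 lN.
  apply/seteqP; split=> q; last by move=> ->; split; exact: Sigma1.
  move=> [/(SigmaP lN)[u [i [g [uE ->]]]] /(SigmaP lN)[v [j [k [vE /cosetgP Nuv]]]]].
  apply/cosetg_eq1/normalJ.
  (* Conjugation by [k^-1] gathers both conjugators into [g * k^-1], acting on the power of [u]
     alone. *)
  apply: (separate_triples fx fy f'x f'y hxy hx hy (j := j) (g := g * k^-1) lN N3 hN uE vE).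
  have [N1 NM NV] := normal_sub N; have := normalJ k^-1 (NV _ Nuv).
  by rewrite invgM invgK conjMg conjVg conjgK conjgM.
Qed.

Lemma not_beauville_lam n : (n <= 2)%N -> ~ beauville (quotg (lam C3C3 n)).
Proof.
move=> n2; apply: not_beauville_exp3 => [q|a b].
  have [g ->] := cosetg_surj q; rewrite -gmulfXn; apply/cosetg_eq1.
  exact/(lam_le n2)/cube_lam2.
have [g ->] := cosetg_surj a; have [k ->] := cosetg_surj b.
rewrite -gmulfR; apply: central_cosetg => u; apply/(lam_le n2)/lamR/lamR; exact: lam0.
Qed.
End BeauvilleC3C3.

(** * Refining the series *)

(** [W n] concatenates the first [n] chains. As no chain is empty, its length is at least [n], so
    the [i]-th term can be read in [W i] without reaching the default of [nth]; longer prefixes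
    agree with it by [Wnth]. *)
Lemma concat_chains (T : Type) (r : rel T) (P : pred T) (a : nat -> T) : P (a 0%N) ->
  (forall n, exists C, [/\ (0 < size C)%N, path r (a n) C, last (a n) C = a n.+1 & all P C]) ->
  exists N : nat -> T, [/\ N 0%N = a 0%N, forall i, r (N i) (N i.+1),
    forall n, exists i, N i = a n & forall i, P (N i)].
Proof.
move=> P0 /choice[C CP]; pose W n := flatten (mkseq C n).
have WS n : W n.+1 = W n ++ C n.
  by rewrite /W /mkseq -addn1 iotaD map_cat flatten_cat /= cats0.
have Wlast n : last (a 0%N) (W n) = a n.
  by elim: n => // n IHn; rewrite WS last_cat IHn; case: (CP n).
have Wpath n : path r (a 0%N) (W n).
  by elim: n => // n IHn; rewrite WS cat_path IHn Wlast; case: (CP n).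
have Wall n : all P (W n).
  by elim: n => // n IHn; rewrite WS all_cat IHn; case: (CP n).
have Wsize n : (n <= size (W n))%N.
  by elim: n => // n IHn; rewrite WS size_cat -addn1 leq_add //; case: (CP n).
pose x0 := a 0%N.
have Wnth m n i : (m <= n)%N -> (i <= size (W m))%N -> nth x0 (x0 :: W n) i = nth x0 (x0 :: W m) i.
  move=> /subnK <- im; elim: (n - m)%N => // k <-; rewrite addSn WS -cat_cons nth_cat ifT //=.
  rewrite ltnS (leq_trans im) //; elim: k => // k IHk.
  by rewrite addSn WS size_cat (leq_trans IHk) ?leq_addr.
exists (fun i => nth x0 (x0 :: W i) i); split=> // [i|n|i].
- rewrite -(Wnth i i.+1) //=; move/(pathP x0): (Wpath i.+1); apply; exact: Wsize.
- exists (size (W n)); rewrite (Wnth n) // -[X in nth _ _ X]/(size (x0 :: W n)).-1 nth_last.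
  exact: Wlast.
- by case: i => [//|i]; move/(all_nthP x0): (Wall i.+1); apply; exact: Wsize.
Qed.

Section Index.
Variable G : groupType.
Implicit Types (N M : nsubgroup G) (g t : G).

Lemma index_eq3 N M t : M `<=` (N : set G) -> (N : set G) t -> ~ (M : set G) t ->
  (M : set G) (t ^+ 3) ->
  (forall g, (N : set G) g -> exists i, (M : set G) ((t ^+ i)^-1 * g)) -> index_eq N M 3.
Proof.
move=> MN Nt Mt Mt3 NM; have [M1 MM MV] := normal_sub M.
pose K g : set G := [set g * k | k in (M : set G)].
have KP g g' : K g = K g' <-> (M : set G) (g^-1 * g').
  split=> [eK|Mgg'].
    have : K g' g' by exists 1; rewrite ?mulg1.
    by rewrite -eK => -[k Mk <-]; rewrite mulKg.
  apply/seteqP; split=> _ [k Mk <-].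
    exists ((g^-1 * g')^-1 * k); last by rewrite invgM invgK !mulgA mulgV mul1g.
    by apply: MM => //; exact: MV.
  by exists (g^-1 * g' * k); [exact: MM | rewrite !mulgA mulgV mul1g].
rewrite /index_eq (_ : lcosets_of N M = (fun i => K (t ^+ i)) @` `I_3); last first.
  apply/seteqP; split=> [_ [g Ng <-]|_ [i _ <-]].
    have [i Mi] := NM g Ng; exists (i %% 3)%N; first by rewrite /= ltn_mod.
    apply/KP; move: Mi; rewrite (_ : t ^+ i = t ^+ (i %% 3) * t ^+ 3 ^+ (i %/ 3)).
      rewrite invgM -mulgA => Mi.
      by have := MM _ _ (subgroupX (i %/ 3) (normal_sub M) Mt3) Mi; rewrite mulVKg.
    by rewrite -expgnA mulnC -expgnDr addnC -divn_eq.
  exists (t ^+ i) => //; exact: subgroupX (normal_sub _) Nt.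
apply: inj_card_eq => i j; rewrite !inE /= => i3 j3 /KP.
have Mt2 : ~ (M : set G) (t ^+ 2).
  by move=> Mt2; apply: Mt; have := MM _ _ Mt3 (MV _ Mt2); rewrite expgS mulgK.
have V u : (M : set G) u^-1 -> (M : set G) u by move=> /MV; rewrite invgK.
case: i i3 => [|[|[|//]]] _; case: j j3 => [|[|[|//]]] _ //; rewrite ?expg0 ?invg1 ?mul1g ?mulg1 //.
- by move=> /V.
- by rewrite expg1 expg2 mulKg.
- by move=> /V.
- by move=> /MV; rewrite invgM invgK expg1 expg2 mulKg.
Qed.

Definition index3_step (N M : nsubgroup G) : bool := `[< M `<=` (N : set G) /\ index_eq N M 3 >].

(** [x ^ g = x * [~ x, g]], and the commutator already lies in [lam n.+1]. *)
Lemma normal_between n (H : set G) : is_subgroup H -> lam G n.+1 `<=` H ->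
  H `<=` lam G n -> normal_subgroup H.
Proof.
move=> sH lH Hl; split=> // x g Hx; have [_ HM _] := sH.
have -> : x ^ g = x * [~ x, g] by rewrite commgEl mulVKg.
by apply: HM => //; apply/lH/lamR/Hl.
Qed.

(** [M'] is the preimage of the cyclic group generated by the class of [t], whose cube is trivial
    because [t ^+ 3] lies in [lam n.+1]. *)
Lemma nsubgroup_adjoin n M t : lam G n.+1 `<=` (M : set G) -> M `<=` (lam G n : set G) ->
  (lam G n : set G) t -> exists M' : nsubgroup G,
  [/\ M `<=` (M' : set G), (M' : set G) t, M' `<=` (lam G n : set G),
      forall H, is_subgroup H -> M `<=` H -> H t -> M' `<=` H
    & ~ (M : set G) t -> index_eq M' M 3].
Proof.
move=> lM Ml lt; pose H := [set g | gen [set cosetg M t] (cosetg M g)].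
have sH : is_subgroup H by exact: (preimage_subgroup (cosetg M) (subgroup_gen _)).
have Mt3 : (M : set G) (t ^+ 3) by exact/lM/lamX.
have t3 : cosetg M t ^+ 3 = 1 by rewrite -gmulfXn; exact/cosetg_eq1.
have MH : M `<=` H.
  by move=> g /cosetg_eq1; rewrite /H /= => ->; case: (subgroup_gen [set cosetg M t]).
have HP g : H g -> exists i, (M : set G) ((t ^+ i)^-1 * g).
  move=> /(gen1P t3)[i]; rewrite -gmulfXn => /esym/cosetgP Mg.
  by exists i.
have minH (K : set G) : is_subgroup K -> M `<=` K -> K t -> H `<=` K.
  move=> sK MK Kt g /HP[i /MK Kg]; have [_ KM _] := sK.
  by rewrite -[g](mulVKg (t ^+ i)); apply: KM => //; exact: subgroupX.
have Hl : H `<=` (lam G n : set G) by apply: minH lt => //; exact: normal_sub.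
have nH : normal_subgroup H by apply: (normal_between sH _ Hl) => g /lM/MH.
have Ht : H t by exact: sub_gen.
by exists (NSubgroup nH); split=> // Mt; exact: (index_eq3 (t := t)).
Qed.

(** The elements of [T] are adjoined to [M] one at a time, skipping those already present. The chain
    descends, so the smaller [M] is appended at its end. *)
Lemma refinement_chain n (T : seq G) M N : lam G n.+1 `<=` (M : set G) ->
  M `<=` (N : set G) -> N `<=` (lam G n : set G) -> [set` T] `<=` (N : set G) ->
  (forall H, is_subgroup H -> M `<=` H -> [set` T] `<=` H -> N `<=` H) ->
  exists C : seq (nsubgroup G), [/\ path index3_step N C, last N C = M &
    all (fun B : nsubgroup G => `[< M `<=` (B : set G) /\ B `<=` (N : set G) >]) C].
Proof.
elim: T M => [|t T IHT] M lM MN Nl TN minN.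
  exists [::]; split=> //; apply: nsubgroup_inj; apply/seteqP; split=> //.
  by apply: minN => //; exact: normal_sub.
have Nt : (N : set G) t by apply: TN; exact: mem_head.
have TN' : [set` T] `<=` (N : set G) by move=> g gT; apply: TN; exact: mem_behead.
have [Mt|Mt] := pselect ((M : set G) t).
  apply: IHT => // H sH MH TH; apply: minN => // g /=; rewrite inE => /orP[/eqP->|/TH//].
  exact: MH.
have [M' [MM' M't M'l minM' iM]] := nsubgroup_adjoin lM (subset_trans MN Nl) (Nl _ Nt).
have M'N : M' `<=` (N : set G) by apply: minM' => //; exact: normal_sub.
have [||C [Cp Cl Call]] := IHT M' _ M'N Nl TN'; first exact: subset_trans MM'.
  move=> H sH M'H TH; apply: minN => // [g /MM'/M'H//|g /=].
  by rewrite inE => /orP[/eqP->|/TH//]; exact: M'H.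
exists (rcons C M); rewrite last_rcons rcons_path Cp Cl all_rcons; split=> //.
  by apply/asboolP; split=> //; exact: iM.
apply/andP; split; first by apply/asboolP; split.
by apply: sub_all Call => B /asboolP[M'B BN]; apply/asboolP; split=> // g /MM'/M'B.
Qed.
End Index.

(** * Chains between consecutive terms of the series *)

Section LevelChains.
Variable h : UMagmaMorphism.type C3C3 eis_group.
Hypothesis hxy : h (cx * cy) = sdp0 eis_omega3 (1, 0)%R.
Hypotheses (hx : (h cx).2 = (- 1)%R) (hy : (h cy).2 = 1%R).

Local Notation theta := (sdp_theta eis_omega).

Lemma eis_iter_theta_inj n (a b : eis) : iter n theta a = iter n theta b -> a = b.
Proof.
elim: n => //= n IHn e; apply: IHn; move: e.
move: (iter n theta a) (iter n theta b) => {}a {}b /(congr1 (fun p : eis => (p.1, p.2))).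
by rewrite /sdp_theta !eis_coordB /= => -[e1 e2]; apply: eis_eq; lia.
Qed.

(** The cube root of unity is 1 modulo [theta], so the class of an element is that of the sum of its
    coordinates modulo 3. *)
Lemma eis_mod_theta (w : eis) : exists (c : nat) v, w = ((1, 0) *+ c + theta v)%R.
Proof.
exists `|((w.1 + w.2) %% 3)%Z|%N, (w.2 - 2 * ((w.1 + w.2) %/ 3)%Z, - ((w.1 + w.2) %/ 3)%Z)%R.
have := divz_eq (w.1 + w.2)%R 3; have := @modz_ge0 (w.1 + w.2)%R 3 isT.
move: ((w.1 + w.2) %/ 3)%Z ((w.1 + w.2) %% 3)%Z => q r r0 e.
apply: (addIr (- theta (w.2 - 2 * q, - q)))%R; rewrite addrK.
by apply: eis_eq; rewrite eis_coordB eis_coordMn /sdp_theta eis_coordB /=; lia.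
Qed.

(** Each further commutator with [cx] multiplies the translation by [theta]; the start is [cx * cy],
    the translation by 1. *)
Lemma lam_witness n : exists2 t, (lam C3C3 n : set C3C3) t &
  h t = sdp0 eis_omega3 (iter n theta (1, 0)%R).
Proof.
elim: n => [|n [t lt ht]]; first by exists (cx * cy).
exists [~ t, cx]; first exact: lamR.
by rewrite gmulfR ht commgEl sdp0J hx opprK sdp0V sdp0M addrC.
Qed.

Lemma lam_filter n c : (lam C3C3 n.+1 : set C3C3) c -> sdp_filter n.+1 (h c).
Proof. exact: (sdp_hom_lam eis_theta3 (@gmulfM _ _ h)). Qed.

(** [K] is the part of [lam n] acting through [theta^(n+1) Z[w]]; modulo it, [lam n] becomes
    [theta^n Z[w] / theta^(n+1) Z[w]], of order 3, generated by the element of [lam_witness]. *)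
Lemma lam_first_step n : (0 < n)%N -> exists K : nsubgroup C3C3,
  [/\ lam C3C3 n.+1 `<=` (K : set C3C3), K `<=` (lam C3C3 n : set C3C3),
    forall c, (K : set C3C3) c -> sdp_filter n.+1 (h c) & index_eq (lam C3C3 n) K 3].
Proof.
case: n => // n _; pose H := [set c | (lam C3C3 n.+1 : set C3C3) c /\ sdp_filter n.+2 (h c)].
have sF : is_subgroup [set c | sdp_filter n.+2 (h c)].
  by apply: (preimage_subgroup h); exact: subgroup_sdp_filter.
have sH : is_subgroup H.
  have [F1 FM FV] := sF; have [l1 lM lV] := normal_sub (lam C3C3 n.+1).
  split=> [|a b [la Fa] [lb Fb]|a [la Fa]]; split; first exact: l1.
  - exact: F1.
  - exact: lM.
  - exact: FM.
  - exact: lV.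
  - exact: FV.
have lH : lam C3C3 n.+2 `<=` H by move=> c lc; split; [exact: lamS | exact: lam_filter].
have Hl : H `<=` (lam C3C3 n.+1 : set C3C3) by move=> c [].
exists (NSubgroup (normal_between sH lH Hl)); split=> //; first by move=> c [].
have [t lt ht] := lam_witness n.+1.
apply: (index_eq3 (t := t)) => //.
(* Otherwise cancelling powers of [theta] would make 1 a multiple of [theta], hence of 3. *)
- case=> _; rewrite ht => -[w _ /(congr1 fst)] /=; rewrite -!iterS iterSr.
  move=> /eis_iter_theta_inj e.
  by have [j] := eis_theta_dvd3 (i := 1) e; lia.
- exact/lH/lamX.
- move=> g lg; have [w _ hg] := lam_filter lg; have [c [v wE]] := eis_mod_theta w.
  exists c; split.
    have [_ lM lV] := normal_sub (lam C3C3 n.+1).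
    by apply: lM => //; apply: lV; exact: subgroupX (normal_sub _) _.
  rewrite gmulfM gmulfV gmulfXn ht -hg sdp0X sdp0V sdp0M wE sdp_thetaD.
  by rewrite sdp_thetaMn addKr -iterSr; exists v.
Qed.

(** The first step goes down to the [K] of [lam_first_step]; representatives of the finite
    [K / lam n.+1] supply the others. Every new term lies between [lam n.+1] and [K], so
    [beauville_quotient] applies to it with [n.+1]. *)
Lemma level_chain n : (3 <= n)%N -> exists C : seq (nsubgroup C3C3),
  [/\ (0 < size C)%N, path (@index3_step C3C3) (lam C3C3 n) C, last (lam C3C3 n) C = lam C3C3 n.+1
    & all (fun N => `[< beauville (quotg N) >]) C].
Proof.
move=> n3; have [K [lK Kl KF iK]] := lam_first_step (ltnW (ltnW n3)).
have genC : gen [set` [:: cx; cy]] = setT by rewrite set_seq2 gen_cxy.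
have fK : finite_set (cosetg (lam C3C3 n.+1) @` K).
  by apply: sub_finite_set (finite_lam_factor n genC); exact: image_subset.
have [qs eqs] := (finite_seqP _).1 fK.
have [|||C [Cp Cl Call]] := refinement_chain (T := map repr qs) (M := lam C3C3 n.+1) (N := K) _ lK Kl.
- by [].
- move=> _ /mapP[q qqs ->]; have : [set` qs] q by [].
  rewrite -eqs => -[c Kc <-]; have [_ KM KV] := normal_sub K.
  have := KV _ (lK _ (repr_cosetg (lam C3C3 n.+1) c)); rewrite invgM invgK => Kc'.
  by rewrite -[repr _](mulKg c^-1) invgK; exact: KM.
- move=> H sH lH TH g Kg; have [_ HM _] := sH.
  rewrite -[g](mulVKg (repr (cosetg (lam C3C3 n.+1) g))); apply: HM; last exact/lH/repr_cosetg.
  apply: TH => /=; apply: map_f; have : [set` qs] (cosetg (lam C3C3 n.+1) g) by rewrite -eqs; exists g.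
  by [].
have beauvilleK (N : nsubgroup C3C3) : lam C3C3 n.+1 `<=` (N : set C3C3) -> N `<=` (K : set C3C3) -> beauville (quotg N).
  move=> lN NK; apply: (beauville_quotient hxy hx hy lN) => c /NK; last exact: KF.
  by move=> /Kl; exact: lam_le.
exists (K :: C); split=> //=.
  by rewrite Cp andbT; apply/asboolP.
apply/andP; split; first exact/asboolP/beauvilleK.
by apply: sub_all Call => N /asboolP[lN NK]; exact/asboolP/beauvilleK.
Qed.
End LevelChains.

Theorem theorem3p5 :
  (forall n : nat, (1 <= n)%N ->
     (beauville (quotg (pcentral C3C3 3 n)) <-> (4 <= n)%N)) /\
  (exists N : nat -> nsubgroup C3C3,
     [/\ N 0%N = pcentral C3C3 3 4 :> set C3C3,
         forall i : nat, N i.+1 `<=` N i,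
         forall n : nat, (4 <= n)%N ->
           exists i : nat, N i = pcentral C3C3 3 n :> set C3C3,
         forall i : nat, index_eq (N i) (N i.+1) 3
       & forall i : nat, beauville (quotg (N i))]).
Proof.
have [h [hxy hx hy]] := exists_eis_hom.
have beauville_lam n : (3 <= n)%N -> beauville (quotg (lam C3C3 n)).
  move=> n3; apply: (beauville_quotient hxy hx hy (n := n)) => //; first exact: lam_le.
  by case: n n3 => // n _ c; exact: lam_filter.
split=> [[|n] // _|].
  split=> [bn|]; last exact: beauville_lam.
  by rewrite ltnNge; apply/negP => /not_beauville_lam; apply.
(* [lam (n + 3)] has index [n + 4] when counting from 1, so the sequence starts at
   [pcentral C3C3 3 4]. *)
have [|n|N [N0 Nstep Nlam NB]] := @concat_chains _ (@index3_step C3C3)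
    (fun N => `[< beauville (quotg N) >]) (fun n => lam C3C3 (n + 3)).
- exact/asboolP/beauville_lam.
- by apply: (level_chain hxy hx hy); rewrite leq_addl.
exists N; split=> [|i|n n4|i|i].
- by rewrite N0.
- by have /asboolP[] := Nstep i.
- have [i ei] := Nlam (n - 4)%N; exists i; rewrite ei /lam.
  by rewrite (_ : (n - 4 + 3).+1 = n) //; lia.
- by have /asboolP[] := Nstep i.
- exact/asboolP.
Qed.
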